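(* Let $I\subset\mathbb{R}$ be an interval, let $y_0>0$, and let $f$ be a holomorphic function on the rectangle $R^+(I,y_0)=\{x+iy: x\in I,\ 0\le y\le y_0\}$. Let $A,\lambda,L>0$, and suppose: (a) (Lower edge) $f(x)$ is real with $|f(x)|\le A$ for all $x\in I$. (b) (Upper edge) $|f(x+iy_0)|\le Ae^{\lambda y_0}$ for all $x\in I$. (c) (Vertical edges) $|f(x+iy)|\le A\exp\left(\lambda y+e^{\frac{\pi L}{4y_0}}\right)$ for all $x\in\partial I$ and $0\le y\le y_0$. Let $x\in I$ with $\mathrm{dist}(x,\partial I)\ge L$. Then (with all implied constants in $O(\cdot)$ absolute): (i) $$|f'(x)|\le A\lambda\left(1+O\left(e^{-\frac{\pi L}{4y_0}}\right)+O\left(\frac{1}{\lambda\min(y_0,L)}\right)\right).$$ (ii) $$\left|f(x)+\frac{if'(x)}{\lambda}\right|\le A\left(1+O\left(e^{-\frac{\pi L}{4y_0}}\right)+O\left(\frac{1}{\lambda\min(y_0,L)}\right)\right).$$ (iii) For any $0\le y\le y_0$, $$|f(x+iy)|\le A\left(1+O\left(e^{-\frac{\pi L}{4y_0}}\right)\right)\cosh\left(\left(1+O\left(\frac{1}{\lambda\min(y_0,L)}\right)\right)\lambda y\right).$$ (iv) If $0<r<\min(y_0,L)/4$ and $f(x)\ne0$, then the number of zeroes of $f$ (extended below the real axis by reflection $f(\overline z)=\overline{f(z)}$) in the disk $D(x,r)=\{z:|z-x|<r\}$ is at most $O\left(1+\lambda r+\log\frac{A}{|f(x)|}\right)$.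
   Context: All intervals have positive finite length; $\partial I$ denotes the set of endpoints of $I$. $X=O(Y)$ means $|X|\le CY$ for an absolute constant $C>0$. *)

(* Defs.v *)
From Stdlib Require Import Reals List.
From Coquelicot Require Export Coquelicot.
Open Scope R_scope.

(* The closed rectangle R^+(I, y0) over the compact interval I = [a, b]. *)
Definition rectangle (a b y0 : R) (z : C) : Prop :=
  a <= Re z <= b /\ 0 <= Im z <= y0.

(* Holomorphy on a set that need not be open means complex differentiability
   on some open neighbourhood of it. *)
Definition holomorphic_on (f : C -> C) (S : C -> Prop) : Prop :=
  exists U : C -> Prop,
    open U /\ (forall z, S z -> U z) /\ (forall z, U z -> ex_derive f z).

Definition dist_endpoints (a b x : R) : R := Rmin (Rabs (x - a)) (Rabs (x - b)).

Definition disk (c : C) (r : R) (z : C) : Prop := Cmod (z - c) < r.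

(* [X = O(Y)] with the implied constant K made explicit. *)
Definition bigO (K X Y : R) : Prop := Rabs X <= K * Y.

Definition reflect_ext (f : C -> C) (z : C) : C :=
  if Rle_dec 0 (Im z) then f z else Cconj (f (Cconj z)).

(* F vanishes at z to order exactly n (n = 0 meaning F z <> 0). *)
Definition zero_order (F : C -> C) (z : C) (n : nat) : Prop :=
  exists g : C -> C,
    holomorphic_on g (fun w => w = z) /\ g z <> RtoC 0 /\
    locally z (fun w => F w = ((w - z) ^ n * g w)%C).

(* zs lists every zero of F in D, repeated according to multiplicity, so that
   [length zs] is the number of zeroes of F in D. *)
Definition zeros_in (F : C -> C) (D : C -> Prop) (zs : list C) : Prop :=
  (forall z, In z zs -> D z) /\
  (forall z, D z -> zero_order F z (count_occ Ceq_dec zs z)).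

(* Main.v *)
Require Import Defs.
From Stdlib Require Import Reals List.
From Coquelicot Require Import Coquelicot.
From Stdlib Require Import Lra Classical ClassicalEpsilon.
Open Scope R_scope.

(* Put m = min(y0, L). Comparing log |f| with a harmonic majorant on the whole rectangle
   gives |f(t + iy)| <= A exp(lambda y + O(1)) for |t - x| <= m. On the square of side m
   above x the Green function of [-1, 1], evaluated at f / A, vanishes on the real axis and
   is at most lambda y + O(1) on the other sides, so it is at most (lambda + O(1/m)) y at
   x + iy: f(x + iy) / A lies in the ellipse with foci -1, 1 and semi-axes cosh t, sinh t
   for t = (lambda + O(1/m)) y. This gives (iii), and y -> 0 gives (ii), hence (i).
   Instead of subharmonic functions, the maximum modulus principle is applied to T_n(f / A)
   times an exponential, with T_n the Chebyshev polynomials and n -> oo: log |T_n| / n tends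
   to the Green function. For (iv), the zeros are divided out one by one. The maximum
   principle and the holomorphy of the quotients come from Goursat's theorem on rectangles. *)

(** * Complex differentiability *)

(** What sharpens [exp] to [cosh] is that [f] is real, not merely bounded, on the lower edge: the
    Green function of [-1, 1] vanishes at [f / A] there. A majorant of log |f / A| alone would give
    |f(x + iy)| <= A exp(ka y), and its limit y -> 0 carries no information on f'(x). The large
    growth allowed on the vertical edges costs only a bounded factor: within distance m of x the
    weight that dominates it is at most 12, so the first error term can be taken to be 0 everywhere.
    The remaining loss, 14 on three sides of the square, becomes 28 y/m above its center. Being
    proportional to y, it can be moved into the argument of [cosh], where it is the relative error
    28/(lambda m). Constants in the Cauchy estimates may be crude, because passing to powers and
    taking n-th roots removes any fixed factor; the same mechanism turns bounds on all the T_n into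
    membership in an ellipse. *)

Lemma Cmod_coord_lt (u : C) (e : R) :
  Rabs (Re u) < e / 2 -> Rabs (Im u) < e / 2 -> Cmod u < e.
Proof.
  intros H1 H2.
  destruct u as [p q]; simpl in *.
  replace (p, q) with (RtoC p + Ci * RtoC q)%C
    by (apply injective_projections; simpl; ring).
  apply Rle_lt_trans with (1 := Cmod_triangle _ _).
  rewrite Cmod_mult, Cmod_Ci, !Cmod_R. lra.
Qed.

Lemma im_le_Cmod (u : C) : Rabs (Im u) <= Cmod u.
Proof.
  apply Rle_trans with (2 := Rmax_Cmod u). apply Rmax_r.
Qed.

(** Neighborhoods on the product [R * R] come from the sup norm of the coordinates; replacing it by
    [Cmod] costs at most a factor 2 in the radius. *)
Lemma locally_Cmod (z : C) (P : C -> Prop) :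
  locally z P <-> exists d, 0 < d /\ forall w, Cmod (w - z)%C < d -> P w.
Proof.
  split.
  - intros [d Hd]. exists d. split. apply cond_pos.
    intros w Hw. apply Hd. split; simpl.
    + change (Rabs (Re (w - z)%C) < d). eapply Rle_lt_trans. apply re_le_Cmod. exact Hw.
    + change (Rabs (Im (w - z)%C) < d). eapply Rle_lt_trans. apply im_le_Cmod. exact Hw.
  - intros [d [Hd H]]. assert (Hd2 : 0 < d / 2) by lra.
    exists (mkposreal _ Hd2). intros w [H1 H2]. apply H.
    apply Cmod_coord_lt; [exact H1 | exact H2].
Qed.

(** First-order expansion, written without division so that [w = z] needs no separate case. *)
Definition cderiv (f : C -> C) (z l : C) : Prop :=
  forall e, 0 < e -> exists d, 0 < d /\
    forall w, Cmod (w - z)%C < d ->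
      Cmod (f w - f z - l * (w - z))%C <= e * Cmod (w - z)%C.

Definition cdiff (f : C -> C) (z : C) : Prop := exists l, cderiv f z l.

Lemma is_derive_cderiv (f : C -> C) (z l : C) :
  @is_derive C_AbsRing C_NormedModule f z l <-> cderiv f z l.
Proof.
  split.
  - intros [_ H] e He.
    specialize (H z (fun P HP => HP) (mkposreal e He)).
    (* [C] carries two uniform structures, one from [Cmod] and one from the product [R * R];
       [locally_C] identifies their neighborhoods. *)
    apply (locally_C z) in H. apply locally_Cmod in H. destruct H as [d [Hd H]].
    exists d. split. exact Hd. intros w Hw. specialize (H w Hw). simpl in H.
    unfold norm, minus, plus, opp, scal in H; simpl in H. unfold mult in H; simpl in H.
    replace (f w - f z - l * (w - z))%C with (f w + - f z + - ((w + - z) * l))%C by ring.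
    exact H.
  - intros H. split. apply is_linear_scal_l.
    intros x Hx e.
    apply (is_filter_lim_locally_unique (K := C_AbsRing) (V := AbsRing_NormedModule C_AbsRing)) in Hx.
    subst x.
    apply (locally_C z). apply locally_Cmod. destruct (H e (cond_pos e)) as [d [Hd H']].
    exists d. split. exact Hd. intros w Hw. specialize (H' w Hw).
    unfold norm, minus, plus, opp, scal; simpl. unfold mult; simpl.
    replace (f w - f z - l * (w - z))%C with (f w + - f z + - ((w + - z) * l))%C in H' by ring.
    exact H'.
Qed.
Lemma C_derive_cderiv (f : C -> C) (z l : C) : cderiv f z l -> C_derive f z = l.
Proof. intros H. apply is_C_derive_unique. apply is_derive_cderiv, H. Qed.

Definition ccont (f : C -> C) (z : C) : Prop :=
  forall e, 0 < e -> exists d, 0 < d /\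
    forall w, Cmod (w - z)%C < d -> Cmod (f w - f z)%C < e.

Lemma Cmod_sub_comm (u v : C) : Cmod (u - v)%C = Cmod (v - u)%C.
Proof. rewrite <- Cmod_opp. f_equal. ring. Qed.

Lemma cderiv_lipschitz (f : C -> C) (z l : C) : cderiv f z l ->
  exists d, 0 < d /\ forall w, Cmod (w - z)%C < d ->
    Cmod (f w - f z)%C <= (Cmod l + 1) * Cmod (w - z)%C.
Proof.
  intros H. destruct (H 1 Rlt_0_1) as [d [Hd H1]].
  exists d. split. exact Hd. intros w Hw.
  replace (f w - f z)%C with ((f w - f z - l * (w - z)) + l * (w - z))%C by ring.
  eapply Rle_trans. apply Cmod_triangle. rewrite Cmod_mult.
  specialize (H1 w Hw). lra.
Qed.

Lemma cderiv_ccont (f : C -> C) (z l : C) : cderiv f z l -> ccont f z.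
Proof.
  intros H e He. destruct (cderiv_lipschitz f z l H) as [d [Hd H1]].
  assert (Hl := Cmod_ge_0 l).
  exists (Rmin d (e / (Cmod l + 1))). split.
  - apply Rmin_pos. exact Hd. apply Rdiv_lt_0_compat; lra.
  - intros w Hw. eapply Rle_lt_trans. apply H1.
    eapply Rlt_le_trans. exact Hw. apply Rmin_l.
    assert (Hw' : Cmod (w - z)%C < e / (Cmod l + 1)).
    { eapply Rlt_le_trans. exact Hw. apply Rmin_r. }
    apply (Rmult_lt_compat_l (Cmod l + 1)) in Hw'; [|lra].
    replace ((Cmod l + 1) * (e / (Cmod l + 1))) with e in Hw' by (field; lra).
    exact Hw'.
Qed.

Lemma cdiff_ccont (f : C -> C) (z : C) : cdiff f z -> ccont f z.
Proof. intros [l H]. exact (cderiv_ccont _ _ _ H). Qed.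

Lemma cderiv_ext_loc (f g : C -> C) (z l : C) (d : R) : 0 < d ->
  (forall w, Cmod (w - z)%C < d -> f w = g w) -> cderiv f z l -> cderiv g z l.
Proof.
  intros Hd Hfg H e He. destruct (H e He) as [d' [Hd' H']].
  exists (Rmin d d'). split. apply Rmin_pos; assumption.
  intros w Hw. rewrite <- !Hfg.
  - apply H'. eapply Rlt_le_trans. exact Hw. apply Rmin_r.
  - replace (z - z)%C with (RtoC 0) by ring. rewrite Cmod_0. exact Hd.
  - eapply Rlt_le_trans. exact Hw. apply Rmin_l.
Qed.

Lemma cderiv_const (c z : C) : cderiv (fun _ => c) z 0.
Proof.
  intros e He. exists 1. split. lra. intros w _.
  replace (c - c - 0 * (w - z))%C with (RtoC 0) by ring. rewrite Cmod_0.
  apply Rmult_le_pos. lra. apply Cmod_ge_0.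
Qed.

Lemma cderiv_id (z : C) : cderiv (fun w => w) z 1.
Proof.
  intros e He. exists 1. split. lra. intros w _.
  replace (w - z - 1 * (w - z))%C with (RtoC 0) by ring. rewrite Cmod_0.
  apply Rmult_le_pos. lra. apply Cmod_ge_0.
Qed.

Lemma cderiv_plus (f g : C -> C) (z l m : C) :
  cderiv f z l -> cderiv g z m -> cderiv (fun w => f w + g w)%C z (l + m).
Proof.
  intros Hf Hg e He. assert (He2 : 0 < e / 2) by lra.
  destruct (Hf _ He2) as [d1 [Hd1 H1]]. destruct (Hg _ He2) as [d2 [Hd2 H2]].
  exists (Rmin d1 d2). split. apply Rmin_pos; assumption.
  intros w Hw.
  replace (f w + g w - (f z + g z) - (l + m) * (w - z))%C with
    ((f w - f z - l * (w - z)) + (g w - g z - m * (w - z)))%C by ring.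
  eapply Rle_trans. apply Cmod_triangle.
  assert (A1 := H1 w (Rlt_le_trans _ _ _ Hw (Rmin_l _ _))).
  assert (A2 := H2 w (Rlt_le_trans _ _ _ Hw (Rmin_r _ _))). lra.
Qed.

Lemma cderiv_mult (f g : C -> C) (z l m : C) :
  cderiv f z l -> cderiv g z m ->
  cderiv (fun w => f w * g w)%C z (l * g z + f z * m).
Proof.
  intros Hf Hg e He.
  destruct (cderiv_lipschitz _ _ _ Hg) as [d0 [Hd0 H0]].
  destruct (cderiv_ccont _ _ _ Hg 1 Rlt_0_1) as [d3 [Hd3 H3]].
  assert (Pl := Cmod_ge_0 l). assert (Pm := Cmod_ge_0 m).
  assert (Pf := Cmod_ge_0 (f z)). assert (Pg := Cmod_ge_0 (g z)).
  assert (E1 : 0 < e / (3 * (Cmod (g z) + 1))) by (apply Rdiv_lt_0_compat; lra).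
  assert (E2 : 0 < e / (3 * (Cmod (f z) + 1))) by (apply Rdiv_lt_0_compat; lra).
  assert (E3 : 0 < e / (3 * ((Cmod l + 1) * (Cmod m + 1)))).
  { apply Rdiv_lt_0_compat. lra. apply Rmult_lt_0_compat. lra. apply Rmult_lt_0_compat; lra. }
  destruct (Hf _ E1) as [d1 [Hd1 H1]]. destruct (Hg _ E2) as [d2 [Hd2 H2]].
  set (d := Rmin (Rmin d0 d1) (Rmin d2 (Rmin d3 (e / (3 * ((Cmod l + 1) * (Cmod m + 1))))))).
  exists d. split. unfold d; repeat apply Rmin_pos; assumption.
  intros w Hw.
  assert (W : Cmod (w - z) < d0 /\ Cmod (w - z) < d1 /\ Cmod (w - z) < d2 /\ Cmod (w - z) < d3
     /\ Cmod (w - z) < e / (3 * ((Cmod l + 1) * (Cmod m + 1)))).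
  { unfold d in Hw. repeat split; eapply Rlt_le_trans; try exact Hw.
    - eapply Rle_trans; apply Rmin_l.
    - eapply Rle_trans. apply Rmin_l. apply Rmin_r.
    - eapply Rle_trans. apply Rmin_r. apply Rmin_l.
    - eapply Rle_trans. apply Rmin_r. eapply Rle_trans. apply Rmin_r. apply Rmin_l.
    - eapply Rle_trans. apply Rmin_r. eapply Rle_trans. apply Rmin_r. apply Rmin_r. }
  destruct W as [W0 [W1 [W2 [W3 W4]]]].
  specialize (H0 w W0). specialize (H1 w W1). specialize (H2 w W2). specialize (H3 w W3).
  (* Each of the three summands receives a third of [e]; the last one is of second order because [g]
     is Lipschitz at [z]. *)
  replace (f w * g w - f z * g z - (l * g z + f z * m) * (w - z))%C with
    ((f w - f z - l * (w - z)) * g w + f z * (g w - g z - m * (w - z))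
      + l * (w - z) * (g w - g z))%C by ring.
  set (h := Cmod (w - z)) in *.
  assert (Ph : 0 <= h) by apply Cmod_ge_0.
  assert (G : Cmod (g w) <= Cmod (g z) + 1).
  { replace (g w) with (g z + (g w - g z))%C by ring. eapply Rle_trans. apply Cmod_triangle. lra. }
  eapply Rle_trans. apply Cmod_triangle.
  replace (e * h) with ((e / 3 * h + e / 3 * h) + e / 3 * h) by field.
  apply Rplus_le_compat. eapply Rle_trans. apply Cmod_triangle. apply Rplus_le_compat.
  - rewrite Cmod_mult.
    replace (e / 3 * h) with (e / (3 * (Cmod (g z) + 1)) * h * (Cmod (g z) + 1)) by (field; lra).
    apply Rmult_le_compat; try apply Cmod_ge_0; assumption.
  - rewrite Cmod_mult.
    apply Rle_trans with ((Cmod (f z) + 1) * (e / (3 * (Cmod (f z) + 1)) * h)).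
    + apply Rmult_le_compat; try apply Cmod_ge_0; try assumption. lra.
    + right. field. lra.
  - rewrite !Cmod_mult. fold h.
    apply Rle_trans with ((Cmod l + 1) * h * ((Cmod m + 1) * (e / (3 * ((Cmod l + 1) * (Cmod m + 1)))))).
    + apply Rmult_le_compat; try apply Cmod_ge_0.
      * apply Rmult_le_pos; lra.
      * apply Rmult_le_compat_r; lra.
      * eapply Rle_trans. exact H0. apply Rmult_le_compat_l; lra.
    + right. field. lra.
Qed.

Lemma cderiv_comp (f g : C -> C) (z l m : C) :
  cderiv g z m -> cderiv f (g z) l -> cderiv (fun w => f (g w)) z (l * m).
Proof.
  intros Hg Hf e He.
  assert (Pl := Cmod_ge_0 l). assert (Pm := Cmod_ge_0 m).
  destruct (cderiv_lipschitz _ _ _ Hg) as [d0 [Hd0 H0]].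
  assert (E1 : 0 < e / (2 * (Cmod m + 1))) by (apply Rdiv_lt_0_compat; lra).
  assert (E2 : 0 < e / (2 * (Cmod l + 1))) by (apply Rdiv_lt_0_compat; lra).
  destruct (Hf _ E1) as [d1 [Hd1 H1]]. destruct (Hg _ E2) as [d2 [Hd2 H2]].
  destruct (cderiv_ccont _ _ _ Hg d1 Hd1) as [d3 [Hd3 H3]].
  exists (Rmin d0 (Rmin d2 d3)). split. repeat apply Rmin_pos; assumption.
  intros w Hw.
  assert (W0 := Rlt_le_trans _ _ _ Hw (Rmin_l _ _)).
  assert (W2 := Rlt_le_trans _ _ _ (Rlt_le_trans _ _ _ Hw (Rmin_r _ _)) (Rmin_l _ _)).
  assert (W3 := Rlt_le_trans _ _ _ (Rlt_le_trans _ _ _ Hw (Rmin_r _ _)) (Rmin_r _ _)).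
  specialize (H0 w W0). specialize (H2 w W2). specialize (H1 _ (H3 w W3)).
  replace (f (g w) - f (g z) - l * m * (w - z))%C with
    ((f (g w) - f (g z) - l * (g w - g z)) + l * (g w - g z - m * (w - z)))%C by ring.
  set (h := Cmod (w - z)) in *.
  assert (Ph : 0 <= h) by apply Cmod_ge_0.
  eapply Rle_trans. apply Cmod_triangle. rewrite Cmod_mult.
  replace (e * h) with (e / 2 * h + e / 2 * h) by field.
  apply Rplus_le_compat.
  - eapply Rle_trans. exact H1.
    apply Rle_trans with (e / (2 * (Cmod m + 1)) * ((Cmod m + 1) * h)).
    apply Rmult_le_compat_l; lra. right; field; lra.
  - apply Rle_trans with ((Cmod l + 1) * (e / (2 * (Cmod l + 1)) * h)).
    apply Rmult_le_compat; try apply Cmod_ge_0; lra.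
    right; field; lra.
Qed.

Lemma cderiv_inv (z : C) : z <> 0 -> cderiv Cinv z (- / (z * z))%C.
Proof.
  intros Hz e He. assert (Pz := proj1 (Cmod_gt_0 z) Hz).
  set (r := Cmod z) in *.
  exists (Rmin (r / 2) (e * (r * r * r) / 2)). split.
  { apply Rmin_pos. lra. apply Rdiv_lt_0_compat; [|lra].
    repeat apply Rmult_lt_0_compat; lra. }
  intros w Hw.
  assert (W1 := Rlt_le_trans _ _ _ Hw (Rmin_l _ _)).
  assert (W2 := Rlt_le_trans _ _ _ Hw (Rmin_r _ _)).
  assert (Hwr : r / 2 <= Cmod w).
  { assert (r <= Cmod w + Cmod (w - z)%C); [|lra].
    rewrite Cmod_sub_comm.
    unfold r. replace z with (w + (z - w))%C at 1 by ring. apply Cmod_triangle. }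
  assert (Hw0 : w <> 0). { apply Cmod_gt_0. lra. }
  replace (/ w - / z - - / (z * z) * (w - z))%C with ((w - z) * ((w - z) * / (w * (z * z))))%C
    by (field; auto).
  rewrite Cmod_mult, Rmult_comm. apply Rmult_le_compat_r. apply Cmod_ge_0.
  rewrite Cmod_mult, Cmod_inv, !Cmod_mult by (repeat apply Cmult_neq_0; auto). fold r.
  apply Rle_trans with (e * (r * r * r) / 2 * / (r / 2 * (r * r))).
  - apply Rmult_le_compat. apply Cmod_ge_0.
    + left. apply Rinv_0_lt_compat. repeat apply Rmult_lt_0_compat; lra.
    + lra.
    + apply Rinv_le_contravar. repeat apply Rmult_lt_0_compat; lra.
      apply Rmult_le_compat_r. apply Rmult_le_pos; lra. exact Hwr.
  - right. field. lra.
Qed.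

Lemma cdiff_ext_loc (f g : C -> C) (z : C) (d : R) : 0 < d ->
  (forall w, Cmod (w - z)%C < d -> f w = g w) -> cdiff f z -> cdiff g z.
Proof. intros Hd H [l Hl]. exists l. exact (cderiv_ext_loc f g z l d Hd H Hl). Qed.

Lemma cdiff_const (c z : C) : cdiff (fun _ => c) z.
Proof. eexists; apply cderiv_const. Qed.

Lemma cdiff_id (z : C) : cdiff (fun w => w) z.
Proof. eexists; apply cderiv_id. Qed.

Lemma cdiff_plus (f g : C -> C) (z : C) :
  cdiff f z -> cdiff g z -> cdiff (fun w => f w + g w)%C z.
Proof. intros [l Hl] [m Hm]. eexists; apply cderiv_plus; eassumption. Qed.

Lemma cdiff_mult (f g : C -> C) (z : C) :
  cdiff f z -> cdiff g z -> cdiff (fun w => f w * g w)%C z.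
Proof. intros [l Hl] [m Hm]. eexists; apply cderiv_mult; eassumption. Qed.

Lemma cdiff_comp (f g : C -> C) (z : C) :
  cdiff g z -> cdiff f (g z) -> cdiff (fun w => f (g w)) z.
Proof. intros [l Hl] [m Hm]. eexists; eapply cderiv_comp; eassumption. Qed.

Lemma cdiff_minus (f g : C -> C) (z : C) :
  cdiff f z -> cdiff g z -> cdiff (fun w => f w - g w)%C z.
Proof.
  intros Hf Hg.
  apply (cdiff_ext_loc (fun w => f w + (- (1)) * g w)%C _ z 1 Rlt_0_1).
  intros; ring.
  apply cdiff_plus. exact Hf. apply cdiff_mult. apply cdiff_const. exact Hg.
Qed.

Lemma cdiff_inv (f : C -> C) (z : C) :
  cdiff f z -> f z <> 0 -> cdiff (fun w => / f w)%C z.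
Proof.
  intros Hf H. apply (cdiff_comp Cinv f). exact Hf. eexists; apply cderiv_inv; exact H.
Qed.

Lemma cdiff_div (f g : C -> C) (z : C) :
  cdiff f z -> cdiff g z -> g z <> 0 -> cdiff (fun w => f w / g w)%C z.
Proof. intros. apply cdiff_mult. assumption. apply cdiff_inv; assumption. Qed.

Lemma cdiff_pow (f : C -> C) (z : C) (n : nat) :
  cdiff f z -> cdiff (fun w => f w ^ n)%C z.
Proof.
  intros Hf. induction n as [|n IH].
  - exact (cdiff_const 1 z).
  - apply (cdiff_mult f (fun w => f w ^ n)%C); assumption.
Qed.

(** * The complex exponential and conjugation *)

Lemma derivable_pt_lim_linear_bound (f : R -> R) (l : R) :
  derivable_pt_lim f 0 l -> forall e, 0 < e -> exists d, 0 < d /\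
    forall h, Rabs h < d -> Rabs (f h - f 0 - l * h) <= e * Rabs h.
Proof.
  intros H e He. destruct (H e He) as [d Hd].
  exists d. split. apply cond_pos. intros h Hh.
  destruct (Req_dec h 0) as [->|Hn].
  - rewrite Rabs_R0. replace (f 0 - f 0 - l * 0) with 0 by ring. rewrite Rabs_R0. lra.
  - specialize (Hd h Hn Hh). rewrite Rplus_0_l in Hd.
    replace (f h - f 0 - l * h) with (((f h - f 0) / h - l) * h) by (field; exact Hn).
    rewrite Rabs_mult. apply Rmult_le_compat_r. apply Rabs_pos. lra.
Qed.

Definition Cexp (z : C) : C := (exp (Re z) * cos (Im z), exp (Re z) * sin (Im z)).

Lemma Cexp_plus (u v : C) : Cexp (u + v) = (Cexp u * Cexp v)%C.
Proof.
  unfold Cexp. rewrite re_plus, im_plus, exp_plus, cos_plus, sin_plus.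
  apply injective_projections; simpl; ring.
Qed.

Lemma Cexp_0 : Cexp 0 = 1.
Proof.
  unfold Cexp; simpl. rewrite exp_0, cos_0, sin_0.
  apply injective_projections; simpl; ring.
Qed.

Lemma Cmod_Cexp (z : C) : Cmod (Cexp z) = exp (Re z).
Proof.
  unfold Cmod, Cexp; simpl.
  replace (exp (Re z) * cos (Im z) * (exp (Re z) * cos (Im z) * 1) +
    exp (Re z) * sin (Im z) * (exp (Re z) * sin (Im z) * 1)) with
    (exp (Re z) * exp (Re z) * ((sin (Im z))² + (cos (Im z))²)) by (unfold Rsqr; ring).
  rewrite sin2_cos2, Rmult_1_r. apply sqrt_square. left; apply exp_pos.
Qed.

Lemma cderiv_Cexp_0 : cderiv Cexp 0 1.
Proof.
  intros e He. set (e' := Rmin (e / 12) 1).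
  assert (He' : 0 < e') by (apply Rmin_pos; lra).
  assert (He12 : e' <= e / 12) by apply Rmin_l.
  assert (He1 : e' <= 1) by apply Rmin_r.
  destruct (derivable_pt_lim_linear_bound exp 1 derivable_pt_lim_exp_0 e' He') as [d1 [Hd1 H1]].
  assert (Dc := derivable_pt_lim_cos 0). rewrite sin_0, Ropp_0 in Dc.
  destruct (derivable_pt_lim_linear_bound cos 0 Dc e' He') as [d2 [Hd2 H2]].
  assert (Ds := derivable_pt_lim_sin 0). rewrite cos_0 in Ds.
  destruct (derivable_pt_lim_linear_bound sin 1 Ds e' He') as [d3 [Hd3 H3]].
  exists (Rmin (Rmin d1 d2) (Rmin d3 e')). split. repeat first [assumption | apply Rmin_pos].
  intros w Hw. replace (w - 0)%C with w in * by ring.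
  assert (W1 := Rlt_le_trans _ _ _ (Rlt_le_trans _ _ _ Hw (Rmin_l _ _)) (Rmin_l _ _)).
  assert (W2 := Rlt_le_trans _ _ _ (Rlt_le_trans _ _ _ Hw (Rmin_l _ _)) (Rmin_r _ _)).
  assert (W3 := Rlt_le_trans _ _ _ (Rlt_le_trans _ _ _ Hw (Rmin_r _ _)) (Rmin_l _ _)).
  assert (W4 := Rlt_le_trans _ _ _ (Rlt_le_trans _ _ _ Hw (Rmin_r _ _)) (Rmin_r _ _)).
  rewrite Cexp_0. destruct w as [x y].
  assert (Hx := re_le_Cmod (x, y)). assert (Hy := im_le_Cmod (x, y)). simpl in Hx, Hy.
  set (h := Cmod (x, y)) in *.
  specialize (H1 x (Rle_lt_trans _ _ _ Hx W1)). specialize (H2 y (Rle_lt_trans _ _ _ Hy W2)).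
  specialize (H3 y (Rle_lt_trans _ _ _ Hy W3)).
  rewrite exp_0 in H1. rewrite cos_0, Rmult_0_l, Rminus_0_r in H2. rewrite sin_0, Rminus_0_r in H3.
  assert (E3 : Rabs (exp x) <= 3).
  { rewrite Rabs_pos_eq by (left; apply exp_pos). apply Rle_trans with (exp 1); [|apply exp_le_3].
    assert (x <= 1). { apply Rle_trans with (Rabs x). apply Rle_abs. lra. }
    destruct (Rle_lt_or_eq_dec _ _ H) as [Hlt|Heq]. left; apply exp_increasing; exact Hlt. right; rewrite Heq; reflexivity. }
  assert (Ph : 0 <= h) by apply Cmod_ge_0.
  assert (Hxe : e' * Rabs x <= e' * h) by (apply Rmult_le_compat_l; lra).
  assert (Hye : e' * Rabs y <= e' * h) by (apply Rmult_le_compat_l; lra).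
  assert (Ee : e' * h <= e / 12 * h) by (apply Rmult_le_compat_r; lra).
  assert (T1 : Rabs (exp x * cos y - 1 - x) <= 4 * (e' * h)).
  { replace (exp x * cos y - 1 - x) with ((exp x - 1 - 1 * x) + exp x * (cos y - 1)) by ring.
    eapply Rle_trans. apply Rabs_triang. rewrite Rabs_mult.
    assert (Rabs (exp x) * Rabs (cos y - 1) <= 3 * (e' * h)).
    { apply Rmult_le_compat; try apply Rabs_pos. exact E3. lra. }
    lra. }
  assert (T2 : Rabs (exp x * sin y - y) <= 5 * (e' * h)).
  { replace (exp x * sin y - y) with (exp x * (sin y - 1 * y) + ((exp x - 1 - 1 * x) * y + x * y)) by ring.
    eapply Rle_trans. apply Rabs_triang. rewrite Rabs_mult.
    assert (Rabs (exp x) * Rabs (sin y - 1 * y) <= 3 * (e' * h)).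
    { apply Rmult_le_compat; try apply Rabs_pos. exact E3. lra. }
    assert (Rabs ((exp x - 1 - 1 * x) * y + x * y) <= 2 * (e' * h)); [|lra].
    eapply Rle_trans. apply Rabs_triang. rewrite !Rabs_mult.
    assert (Rabs x * Rabs y <= e' * h).
    { apply Rmult_le_compat; try apply Rabs_pos; lra. }
    assert (Rabs (exp x - 1 - 1 * x) * Rabs y <= e' * h * 1).
    { apply Rmult_le_compat; try apply Rabs_pos; lra. }
    lra. }
  replace (Cexp (x, y) - 1 - 1 * (x, y))%C with
    (RtoC (exp x * cos y - 1 - x) + Ci * RtoC (exp x * sin y - y))%C
    by (apply injective_projections; simpl; ring).
  eapply Rle_trans. apply Cmod_triangle. rewrite Cmod_mult, Cmod_Ci, !Cmod_R.
  assert (0 <= e' * h) by (apply Rmult_le_pos; lra). lra.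
Qed.

(** Translation of the expansion at 0 through [Cexp w = Cexp z * Cexp (w - z)]. *)
Lemma cderiv_Cexp (z : C) : cderiv Cexp z (Cexp z).
Proof.
  replace (Cexp z) with (0 * Cexp (z - z) + Cexp z * (1 * 1))%C at 1 by ring.
  apply (cderiv_ext_loc (fun w => Cexp z * Cexp (w - z))%C _ z _ 1 Rlt_0_1).
  - intros w _. rewrite <- Cexp_plus. f_equal. ring.
  - apply (cderiv_mult (fun _ => Cexp z) (fun w => Cexp (w - z)) z 0 (1 * 1)).
    + apply cderiv_const.
    + apply (cderiv_comp Cexp (fun w => w - z)%C).
      * replace (RtoC 1) with (1 + 0)%C by ring.
        apply (cderiv_plus (fun w => w) (fun _ => - z)%C). apply cderiv_id. apply cderiv_const.
      * replace (z - z)%C with (RtoC 0) by ring. exact cderiv_Cexp_0.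
Qed.

Lemma cdiff_Cexp (f : C -> C) (z : C) : cdiff f z -> cdiff (fun w => Cexp (f w)) z.
Proof. intros H. apply (cdiff_comp Cexp f). exact H. eexists; apply cderiv_Cexp. Qed.

Lemma cderiv_conj (f : C -> C) (z l : C) :
  cderiv f (Cconj z) l -> cderiv (fun w => Cconj (f (Cconj w))) z (Cconj l).
Proof.
  intros H e He. destruct (H e He) as [d [Hd H']].
  exists d. split. exact Hd. intros w Hw.
  assert (E : Cmod (Cconj w - Cconj z)%C = Cmod (w - z)%C)
    by (rewrite <- Cminus_conj; apply Cmod_conj).
  rewrite <- E in Hw |- *. specialize (H' _ Hw).
  rewrite <- Cmod_conj, !Cminus_conj, Cmult_conj, !Cconj_conj, Cminus_conj.
  exact H'.
Qed.

(** * Integrals along the boundary of a rectangle *)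

Definition path_cont (g : R -> C) (t : R) : Prop :=
  continuous (fun s => Re (g s)) t /\ continuous (fun s => Im (g s)) t.

Lemma path_cont_eps (g : R -> C) (t : R) :
  (forall e, 0 < e -> exists d, 0 < d /\
     forall s, Rabs (s - t) < d -> Cmod (g s - g t)%C < e) -> path_cont g t.
Proof.
  intros H. split; apply filterlim_locally; intros e;
    destruct (H e (cond_pos e)) as [d [Hd H']]; exists (mkposreal d Hd);
    intros s Hs; specialize (H' s Hs).
  - change (Rabs (Re (g s - g t)%C) < e).
    eapply Rle_lt_trans. apply re_le_Cmod. exact H'.
  - change (Rabs (Im (g s - g t)%C) < e).
    eapply Rle_lt_trans. apply im_le_Cmod. exact H'.
Qed.

Lemma path_cont_hor (F : C -> C) (t c : R) :
  ccont F (t, c) -> path_cont (fun s => F (s, c)) t.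
Proof.
  intros H. apply path_cont_eps. intros e He. destruct (H e He) as [d [Hd H']].
  exists d. split. exact Hd. intros s Hs. apply H'.
  replace ((s, c) - (t, c))%C with (RtoC (s - t))
    by (apply injective_projections; simpl; ring).
  rewrite Cmod_R. exact Hs.
Qed.

Lemma path_cont_ver (F : C -> C) (t c : R) :
  ccont F (c, t) -> path_cont (fun s => F (c, s)) t.
Proof.
  intros H. apply path_cont_eps. intros e He. destruct (H e He) as [d [Hd H']].
  exists d. split. exact Hd. intros s Hs. apply H'.
  replace ((c, s) - (c, t))%C with (Ci * RtoC (s - t))%C
    by (apply injective_projections; simpl; ring).
  rewrite Cmod_mult, Cmod_Ci, Cmod_R, Rmult_1_l. exact Hs.
Qed.

Definition CInt (g : R -> C) (a b : R) : C :=
  (RInt (fun t => Re (g t)) a b, RInt (fun t => Im (g t)) a b).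

Definition path_cont_on (g : R -> C) (a b : R) : Prop :=
  forall t, a <= t <= b -> path_cont g t.

Lemma path_cont_on_ex_RInt (g : R -> C) (a b : R) : a <= b -> path_cont_on g a b ->
  ex_RInt (fun t => Re (g t)) a b /\ ex_RInt (fun t => Im (g t)) a b.
Proof.
  intros Hab H. split; apply (ex_RInt_continuous (V := R_CompleteNormedModule));
    intros t Ht; rewrite Rmin_left, Rmax_right in Ht by exact Hab; apply (H t Ht).
Qed.

Lemma CInt_ext (g h : R -> C) (a b : R) : a <= b ->
  (forall t, a <= t <= b -> g t = h t) -> CInt g a b = CInt h a b.
Proof.
  intros Hab H. unfold CInt. f_equal; apply RInt_ext; intros t Ht;
    rewrite Rmin_left, Rmax_right in Ht by exact Hab; rewrite H; auto; lra.
Qed.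

Lemma CInt_plus (g h : R -> C) (a b : R) : a <= b ->
  path_cont_on g a b -> path_cont_on h a b ->
  CInt (fun t => g t + h t)%C a b = (CInt g a b + CInt h a b)%C.
Proof.
  intros Hab Hg Hh.
  destruct (path_cont_on_ex_RInt g a b Hab Hg) as [G1 G2].
  destruct (path_cont_on_ex_RInt h a b Hab Hh) as [H1 H2].
  unfold CInt. apply injective_projections; simpl.
  - apply (RInt_plus (V := R_CompleteNormedModule)); assumption.
  - apply (RInt_plus (V := R_CompleteNormedModule)); assumption.
Qed.

Lemma CInt_scal (k : C) (g : R -> C) (a b : R) : a <= b -> path_cont_on g a b ->
  CInt (fun t => k * g t)%C a b = (k * CInt g a b)%C.
Proof.
  intros Hab Hg.
  destruct (path_cont_on_ex_RInt g a b Hab Hg) as [G1 G2].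
  unfold CInt. apply injective_projections; simpl.
  - etransitivity. apply (RInt_minus (V := R_CompleteNormedModule)
      (fun t => scal (fst k) (Re (g t))) (fun t => scal (snd k) (Im (g t))));
      apply (ex_RInt_scal (V := R_CompleteNormedModule)); assumption.
    rewrite !(RInt_scal (V := R_CompleteNormedModule)) by assumption. reflexivity.
  - etransitivity. apply (RInt_plus (V := R_CompleteNormedModule)
      (fun t => scal (fst k) (Im (g t))) (fun t => scal (snd k) (Re (g t))));
      apply (ex_RInt_scal (V := R_CompleteNormedModule)); assumption.
    rewrite !(RInt_scal (V := R_CompleteNormedModule)) by assumption. reflexivity.
Qed.

Lemma CInt_Chasles (g : R -> C) (a m b : R) : a <= m <= b -> path_cont_on g a b ->
  CInt g a b = (CInt g a m + CInt g m b)%C.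
Proof.
  intros Hm Hg.
  destruct (path_cont_on_ex_RInt g a m) as [G1 G2]. lra. intros t Ht; apply Hg; lra.
  destruct (path_cont_on_ex_RInt g m b) as [H1 H2]. lra. intros t Ht; apply Hg; lra.
  unfold CInt. apply injective_projections; simpl; symmetry;
    apply (RInt_Chasles (V := R_CompleteNormedModule)); assumption.
Qed.

(** The factor 2 comes from estimating the real and imaginary parts separately. *)
Lemma CInt_bound (g : R -> C) (a b M : R) : a <= b -> path_cont_on g a b ->
  (forall t, a <= t <= b -> Cmod (g t) <= M) -> Cmod (CInt g a b) <= 2 * M * (b - a).
Proof.
  intros Hab Hg HM.
  destruct (path_cont_on_ex_RInt g a b Hab Hg) as [G1 G2].
  assert (B1 : Rabs (RInt (fun t => Re (g t)) a b) <= (b - a) * M).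
  { apply (norm_RInt_le_const (V := R_NormedModule) (fun t => Re (g t))). exact Hab.
    - intros t Ht. eapply Rle_trans. apply re_le_Cmod. apply HM; exact Ht.
    - apply (RInt_correct (V := R_CompleteNormedModule)). exact G1. }
  assert (B2 : Rabs (RInt (fun t => Im (g t)) a b) <= (b - a) * M).
  { apply (norm_RInt_le_const (V := R_NormedModule) (fun t => Im (g t))). exact Hab.
    - intros t Ht. eapply Rle_trans. apply im_le_Cmod. apply HM; exact Ht.
    - apply (RInt_correct (V := R_CompleteNormedModule)). exact G2. }
  replace (CInt g a b) with (RtoC (RInt (fun t => Re (g t)) a b)
    + Ci * RtoC (RInt (fun t => Im (g t)) a b))%C
    by (apply injective_projections; simpl; ring).
  eapply Rle_trans. apply Cmod_triangle. rewrite Cmod_mult, Cmod_Ci, !Cmod_R. lra.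
Qed.

Lemma CInt_antiderivative (G g : R -> C) (a b : R) : a <= b -> path_cont_on g a b ->
  (forall t, a <= t <= b -> is_derive (fun s => Re (G s)) t (Re (g t))) ->
  (forall t, a <= t <= b -> is_derive (fun s => Im (G s)) t (Im (g t))) ->
  CInt g a b = (G b - G a)%C.
Proof.
  intros Hab Hg H1 H2. unfold CInt. apply injective_projections; simpl.
  - apply is_RInt_unique.
    apply (is_RInt_derive (V := R_CompleteNormedModule) (fun s => Re (G s)) (fun s => Re (g s)));
      intros t Ht; rewrite Rmin_left, Rmax_right in Ht by exact Hab.
    apply H1; exact Ht. apply (Hg t Ht).
  - apply is_RInt_unique.
    apply (is_RInt_derive (V := R_CompleteNormedModule) (fun s => Im (G s)) (fun s => Im (g s)));
      intros t Ht; rewrite Rmin_left, Rmax_right in Ht by exact Hab.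
    apply H2; exact Ht. apply (Hg t Ht).
Qed.

Definition rect (a b c d : R) (z : C) : Prop := a <= Re z <= b /\ c <= Im z <= d.

Definition rect_bd (a b c d : R) (z : C) : Prop :=
  rect a b c d z /\ (Re z = a \/ Re z = b \/ Im z = c \/ Im z = d).

(** The counterclockwise contour integral; the factor [Ci] is [dz = i dt] on the vertical sides. *)
Definition rect_integral (F : C -> C) (a b c d : R) : C :=
  (CInt (fun t => F (t, c)) a b + Ci * CInt (fun t => F (b, t)) c d
   - CInt (fun t => F (t, d)) a b - Ci * CInt (fun t => F (a, t)) c d)%C.

Lemma rect_bd_paths (F : C -> C) (a b c d : R) : a <= b -> c <= d ->
  (forall z, rect_bd a b c d z -> ccont F z) ->
  path_cont_on (fun t => F (t, c)) a b /\ path_cont_on (fun t => F (t, d)) a b /\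
  path_cont_on (fun t => F (a, t)) c d /\ path_cont_on (fun t => F (b, t)) c d.
Proof.
  intros Hab Hcd H.
  repeat split; first [apply path_cont_hor | apply path_cont_ver]; apply H;
    unfold rect_bd, rect; simpl; lra.
Qed.

Lemma rect_integral_ext (F G : C -> C) (a b c d : R) : a <= b -> c <= d ->
  (forall z, rect_bd a b c d z -> F z = G z) -> rect_integral F a b c d = rect_integral G a b c d.
Proof.
  intros Hab Hcd H. unfold rect_integral.
  rewrite (CInt_ext (fun t => F (t, c)) (fun t => G (t, c))); try assumption.
  rewrite (CInt_ext (fun t => F (t, d)) (fun t => G (t, d))); try assumption.
  rewrite (CInt_ext (fun t => F (a, t)) (fun t => G (a, t))); try assumption.
  rewrite (CInt_ext (fun t => F (b, t)) (fun t => G (b, t))); try assumption.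
  reflexivity.
  all: intros t Ht; apply H; unfold rect_bd, rect; simpl; lra.
Qed.

Lemma rect_integral_plus (F G : C -> C) (a b c d : R) : a <= b -> c <= d ->
  (forall z, rect_bd a b c d z -> ccont F z) ->
  (forall z, rect_bd a b c d z -> ccont G z) ->
  rect_integral (fun z => F z + G z)%C a b c d = (rect_integral F a b c d + rect_integral G a b c d)%C.
Proof.
  intros Hab Hcd HF HG. unfold rect_integral.
  destruct (rect_bd_paths F a b c d Hab Hcd HF) as [F1 [F2 [F3 F4]]].
  destruct (rect_bd_paths G a b c d Hab Hcd HG) as [G1 [G2 [G3 G4]]].
  rewrite !CInt_plus by assumption. ring.
Qed.

Lemma rect_integral_scal (k : C) (F : C -> C) (a b c d : R) : a <= b -> c <= d ->
  (forall z, rect_bd a b c d z -> ccont F z) ->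
  rect_integral (fun z => k * F z)%C a b c d = (k * rect_integral F a b c d)%C.
Proof.
  intros Hab Hcd HF. unfold rect_integral.
  destruct (rect_bd_paths F a b c d Hab Hcd HF) as [F1 [F2 [F3 F4]]].
  rewrite !CInt_scal by assumption. ring.
Qed.

Lemma rect_integral_bound (F : C -> C) (a b c d M : R) : a <= b -> c <= d ->
  (forall z, rect_bd a b c d z -> ccont F z) ->
  (forall z, rect_bd a b c d z -> Cmod (F z) <= M) ->
  Cmod (rect_integral F a b c d) <= 4 * M * ((b - a) + (d - c)).
Proof.
  intros Hab Hcd HF HM.
  destruct (rect_bd_paths F a b c d Hab Hcd HF) as [F1 [F2 [F3 F4]]].
  unfold rect_integral, Cminus.
  assert (B1 := CInt_bound _ _ _ M Hab F1). assert (B2 := CInt_bound _ _ _ M Hab F2).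
  assert (B3 := CInt_bound _ _ _ M Hcd F3). assert (B4 := CInt_bound _ _ _ M Hcd F4).
  simpl in *.
  lapply B1; [clear B1; intros B1 | intros t Ht; apply HM; unfold rect_bd, rect; simpl; lra].
  lapply B2; [clear B2; intros B2 | intros t Ht; apply HM; unfold rect_bd, rect; simpl; lra].
  lapply B3; [clear B3; intros B3 | intros t Ht; apply HM; unfold rect_bd, rect; simpl; lra].
  lapply B4; [clear B4; intros B4 | intros t Ht; apply HM; unfold rect_bd, rect; simpl; lra].
  eapply Rle_trans. apply Cmod_triangle.
  rewrite Cmod_opp, Cmod_mult, Cmod_Ci.
  eapply Rle_trans. apply Rplus_le_compat_r. apply Cmod_triangle.
  rewrite Cmod_opp.
  eapply Rle_trans. apply Rplus_le_compat_r, Rplus_le_compat_r. apply Cmod_triangle.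
  rewrite Cmod_mult, Cmod_Ci. lra.
Qed.

Lemma rect_integral_split_x (F : C -> C) (a m b c d : R) : a <= m <= b -> c <= d ->
  (forall z, rect_bd a b c d z -> ccont F z) ->
  rect_integral F a b c d = (rect_integral F a m c d + rect_integral F m b c d)%C.
Proof.
  intros Hm Hcd HF.
  destruct (rect_bd_paths F a b c d) as [F1 [F2 [F3 F4]]]; try assumption. lra.
  unfold rect_integral.
  rewrite (CInt_Chasles _ a m b Hm F1), (CInt_Chasles _ a m b Hm F2). ring.
Qed.

Lemma rect_integral_split_y (F : C -> C) (a b c m d : R) : a <= b -> c <= m <= d ->
  (forall z, rect_bd a b c d z -> ccont F z) ->
  rect_integral F a b c d = (rect_integral F a b c m + rect_integral F a b m d)%C.
Proof.
  intros Hab Hm HF.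
  destruct (rect_bd_paths F a b c d) as [F1 [F2 [F3 F4]]]; try assumption. lra.
  unfold rect_integral.
  rewrite (CInt_Chasles _ c m d Hm F3), (CInt_Chasles _ c m d Hm F4). ring.
Qed.

(** An explicit antiderivative makes the four sides telescope at the corners. This removes the
    tangent map in Goursat's argument. *)
Lemma rect_integral_affine (p q : C) (a b c d : R) : a <= b -> c <= d ->
  rect_integral (fun z => p + q * z)%C a b c d = 0.
Proof.
  intros Hab Hcd.
  destruct (rect_bd_paths (fun z => p + q * z)%C a b c d Hab Hcd) as [F1 [F2 [F3 F4]]].
  { intros z _. apply cdiff_ccont.
    apply cdiff_plus; [apply cdiff_const|apply cdiff_mult; [apply cdiff_const|apply cdiff_id]]. }
  set (P := fun z : C => (p * z + q * (z * z) / 2)%C).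
  unfold rect_integral.
  rewrite (CInt_antiderivative (fun t => P (t, c)) (fun t => p + q * (t, c))%C a b); try assumption.
  rewrite (CInt_antiderivative (fun t => P (t, d)) (fun t => p + q * (t, d))%C a b); try assumption.
  (* Since [dz = i dt] on a vertical side, the antiderivative in [t] is [P / i = - i P]. *)
  rewrite (CInt_antiderivative (fun t => - Ci * P (b, t)) (fun t => p + q * (b, t))%C c d)%C; try assumption.
  rewrite (CInt_antiderivative (fun t => - Ci * P (a, t)) (fun t => p + q * (a, t))%C c d)%C; try assumption.
  { assert (Ci2 : forall u : C, (Ci * (- Ci * u) = u)%C)
      by (intros u; apply injective_projections; simpl; ring).
    replace (Ci * (- Ci * P (b, d) - - Ci * P (b, c)))%C with (P (b, d) - P (b, c))%C.
    replace (Ci * (- Ci * P (a, d) - - Ci * P (a, c)))%C with (P (a, d) - P (a, c))%C.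
    ring.
    all: apply injective_projections; simpl; ring. }
  all: intros t Ht; unfold P, Cdiv; simpl; auto_derive; trivial; simpl; field.
Qed.

Lemma im_rect_integral (F : C -> C) (a b c d : R) :
  Im (rect_integral F a b c d) =
    RInt (fun t => Im (F (t, c))) a b + RInt (fun t => Re (F (b, t))) c d
    - RInt (fun t => Im (F (t, d))) a b - RInt (fun t => Re (F (a, t))) c d.
Proof. unfold rect_integral, CInt; simpl. ring. Qed.

(** * Goursat's theorem *)

Lemma nested_intervals_point (u v : nat -> R) :
  (forall n, u n <= u (S n)) -> (forall n, v (S n) <= v n) -> (forall n, u n <= v n) ->
  exists X, forall n, u n <= X <= v n.
Proof.
  intros Hu Hv Huv.
  assert (Mu : forall n k, u n <= u (n + k)%nat).
  { intros n k; induction k. rewrite Nat.add_0_r; lra.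
    rewrite Nat.add_succ_r. eapply Rle_trans. apply IHk. apply Hu. }
  assert (Mv : forall n k, v (n + k)%nat <= v n).
  { intros n k; induction k. rewrite Nat.add_0_r; lra.
    rewrite Nat.add_succ_r. eapply Rle_trans. apply Hv. apply IHk. }
  assert (B : forall n m, u n <= v m).
  { intros n m. apply Rle_trans with (u (n + m)%nat). apply Mu.
    apply Rle_trans with (v (n + m)%nat). apply Huv.
    rewrite Nat.add_comm. apply Mv. }
  destruct (completeness (fun t => exists n, t = u n)) as [X [HX1 HX2]].
  - exists (v O). intros t [n ->]. apply B.
  - exists (u O), O. reflexivity.
  - exists X. intros n. split. apply HX1. exists n; reflexivity.
    apply HX2. intros t [m ->]. apply B.
Qed.

(** If [P] failed for the whole, it would fail for some quarter at every stage, and the nested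
    quarters would shrink to a point that contradicts the local hypothesis. A subrectangle is coded
    by its lower left corner and its scale [s], so that degenerate rectangles need no special
    care. *)
Lemma rectangle_bisection (P : R -> R -> R -> Prop) (a b c d : R) :
  a <= b -> c <= d ->
  let inside x y s := a <= x /\ x + s * (b - a) <= b /\ c <= y /\ y + s * (d - c) <= d in
  (forall x y s, 0 < s -> inside x y s ->
     P x y (s / 2) -> P (x + s / 2 * (b - a)) y (s / 2) ->
     P x (y + s / 2 * (d - c)) (s / 2) ->
     P (x + s / 2 * (b - a)) (y + s / 2 * (d - c)) (s / 2) -> P x y s) ->
  (forall p q, a <= p <= b -> c <= q <= d -> exists e, 0 < e /\
     forall x y s, 0 < s < e -> inside x y s ->
       x <= p <= x + s * (b - a) -> y <= q <= y + s * (d - c) -> P x y s) ->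
  P a c 1.
Proof.
  intros Hab Hcd inside Hsplit Hloc. apply NNPP. intros Hn.
  (* The first quarter on which [P] fails is chosen. The fourth is taken without a test: if the
     other three satisfy [P], its failure follows from [Hsplit]. *)
  set (step := fun s (q : R * R) => let (x, y) := q in
    if excluded_middle_informative (P x y (s / 2)) then
      if excluded_middle_informative (P (x + s / 2 * (b - a)) y (s / 2)) then
        if excluded_middle_informative (P x (y + s / 2 * (d - c)) (s / 2)) then
          (x + s / 2 * (b - a), y + s / 2 * (d - c))
        else (x, y + s / 2 * (d - c))
      else (x + s / 2 * (b - a), y)
    else (x, y)).
  set (q := fix q n := match n with O => (a, c) | S n => step ((/ 2) ^ n) (q n) end).
  set (s := fun n => (/ 2) ^ n).
  assert (Hs : forall n, 0 < s n) by (intros n; apply pow_lt; lra).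
  assert (HsS : forall n, s (S n) = s n / 2) by (intros n; unfold s; simpl; field).
  assert (Main : forall n, inside (fst (q n)) (snd (q n)) (s n) /\
    ~ P (fst (q n)) (snd (q n)) (s n)).
  { induction n as [|n [I1 I2]].
    - simpl. split. unfold inside, s; simpl; lra. exact Hn.
    - rewrite HsS. change (q (S n)) with (step (s n) (q n)).
      destruct (q n) as [x y]; simpl in I1, I2 |- *.
      assert (X1 : 0 <= s n * (b - a)) by (apply Rmult_le_pos; [left; apply Hs | lra]).
      assert (X2 : 0 <= s n * (d - c)) by (apply Rmult_le_pos; [left; apply Hs | lra]).
      unfold inside in *.
      destruct (excluded_middle_informative (P x y (s n / 2))) as [Q1|Q1];
      [destruct (excluded_middle_informative (P (x + s n / 2 * (b - a)) y (s n / 2))) as [Q2|Q2];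
      [destruct (excluded_middle_informative (P x (y + s n / 2 * (d - c)) (s n / 2))) as [Q3|Q3]
      |]|]; simpl; (split; [lra|]); try assumption.
      intros Q4. apply I2. apply Hsplit; try assumption. apply Hs. }
  assert (Step : forall n, fst (q n) <= fst (q (S n)) /\ snd (q n) <= snd (q (S n)) /\
     fst (q (S n)) + s (S n) * (b - a) <= fst (q n) + s n * (b - a) /\
     snd (q (S n)) + s (S n) * (d - c) <= snd (q n) + s n * (d - c)).
  { intros n. rewrite HsS. change (q (S n)) with (step (s n) (q n)).
    destruct (q n) as [x y]; simpl.
    assert (X1 : 0 <= s n * (b - a)) by (apply Rmult_le_pos; [left; apply Hs | lra]).
    assert (X2 : 0 <= s n * (d - c)) by (apply Rmult_le_pos; [left; apply Hs | lra]).
    destruct (excluded_middle_informative (P x y (s n / 2))) as [Q1|Q1];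
    [destruct (excluded_middle_informative (P (x + s n / 2 * (b - a)) y (s n / 2))) as [Q2|Q2];
    [destruct (excluded_middle_informative (P x (y + s n / 2 * (d - c)) (s n / 2))) as [Q3|Q3]
    |]|]; simpl; lra. }
  assert (Nx : forall n, 0 <= s n * (b - a)) by (intros n; apply Rmult_le_pos; [left; apply Hs | lra]).
  assert (Ny : forall n, 0 <= s n * (d - c)) by (intros n; apply Rmult_le_pos; [left; apply Hs | lra]).
  destruct (nested_intervals_point (fun n => fst (q n)) (fun n => fst (q n) + s n * (b - a))) as [p1 Hp1];
    try (intros n; specialize (Step n); specialize (Nx n); lra).
  destruct (nested_intervals_point (fun n => snd (q n)) (fun n => snd (q n) + s n * (d - c))) as [p2 Hp2];
    try (intros n; specialize (Step n); specialize (Ny n); lra).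
  simpl in Hp1, Hp2.
  destruct (Hloc p1 p2) as [e [He H]].
  { specialize (Hp1 O). simpl in Hp1. unfold s in Hp1; simpl in Hp1. lra. }
  { specialize (Hp2 O). simpl in Hp2. unfold s in Hp2; simpl in Hp2. lra. }
  destruct (pow_lt_1_zero (/ 2)) with (y := e) as [N HN].
  { rewrite Rabs_pos_eq; lra. } { exact He. }
  destruct (Main N) as [M1 M2]. apply M2. apply H.
  - split. apply Hs. specialize (HN N (le_n N)). rewrite Rabs_pos_eq in HN. exact HN.
    left; apply Hs.
  - exact M1.
  - apply Hp1.
  - apply Hp2.
Qed.

Lemma goursat (F : C -> C) (a b c d : R) : a <= b -> c <= d ->
  (forall z, rect a b c d z -> cdiff F z) -> rect_integral F a b c d = 0.
Proof.
  intros Hab Hcd HF. apply Cmod_eq_0. apply Rle_antisym; [|apply Cmod_ge_0].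
  apply le_epsilon. intros eps Heps. rewrite Rplus_0_l.
  set (l := (b - a) + (d - c)).
  assert (Hl : 0 <= l) by (unfold l; lra).
  (* At scale [s] all points lie within [s * (l + 1)] of the chosen one, so the remainder is at most
     [e * (s * (l + 1))], and [rect_integral_bound] multiplies this by [4 * (s * l)]. Writing
     [l + 1] for [l] avoids division by 0 when the rectangle is a point. *)
  set (e := eps / (4 * (l + 1) * (l + 1))).
  assert (He : 0 < e). { apply Rdiv_lt_0_compat. lra. apply Rmult_lt_0_compat; lra. }
  assert (Hcont : forall z, rect a b c d z -> ccont F z)
    by (intros z Hz; apply cdiff_ccont, HF, Hz).
  (* The bound scales like area, so the bounds for four quarters at scale [s / 2] add up exactly to
     the bound at scale [s]. *)
  set (P := fun x y s => Cmod (rect_integral F x (x + s * (b - a)) y (y + s * (d - c)))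
     <= eps * (s * s)).
  assert (HP : P a c 1).
  { apply (rectangle_bisection P a b c d Hab Hcd); unfold P; clear P.
    - intros x y s Hs Hin H1 H2 H3 H4.
      assert (X1 : 0 <= s * (b - a)) by (apply Rmult_le_pos; lra).
      assert (X2 : 0 <= s * (d - c)) by (apply Rmult_le_pos; lra).
      rewrite (rect_integral_split_x F x (x + s / 2 * (b - a))); [|lra|lra|].
      2: { intros z [[Z1 Z2] _]. apply Hcont. unfold rect; lra. }
      rewrite (rect_integral_split_y F x (x + s / 2 * (b - a)) y (y + s / 2 * (d - c))); [|lra|lra|].
      2: { intros z [[Z1 Z2] _]. apply Hcont. unfold rect; lra. }
      rewrite (rect_integral_split_y F (x + s / 2 * (b - a)) _ y (y + s / 2 * (d - c))); [|lra|lra|].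
      2: { intros z [[Z1 Z2] _]. apply Hcont. unfold rect; lra. }
      replace (x + s * (b - a)) with (x + s / 2 * (b - a) + s / 2 * (b - a)) by field.
      replace (y + s * (d - c)) with (y + s / 2 * (d - c) + s / 2 * (d - c)) by field.
      eapply Rle_trans. apply Cmod_triangle.
      eapply Rle_trans. apply Rplus_le_compat; apply Cmod_triangle. lra.
    - intros p q Hp Hq.
      destruct (HF (p, q)) as [m Hm]. split; simpl; lra.
      destruct (Hm e He) as [dl [Hdl H]].
      exists (dl / (l + 1)). split. apply Rdiv_lt_0_compat; lra.
      intros x y s Hs Hin Hpx Hqy.
      assert (X1 : 0 <= s * (b - a)) by (apply Rmult_le_pos; lra).
      assert (X2 : 0 <= s * (d - c)) by (apply Rmult_le_pos; lra).
      assert (Hsl : s * (l + 1) < dl).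
      { destruct Hs as [Hs1 Hs2]. apply (Rmult_lt_compat_r (l + 1)) in Hs2; [|lra].
        replace (dl / (l + 1) * (l + 1)) with dl in Hs2 by (field; lra). exact Hs2. }
      (* The tangent map of [F] at [(p, q)]: its contour integral is 0, so [F] may be replaced by
         the remainder [E]. *)
      set (A := fun z : C => (F (p, q) - m * (p, q) + m * z)%C).
      set (E := fun z : C => (F z + - (1) * A z)%C).
      assert (HA : forall z, cdiff A z).
      { intros z. apply cdiff_plus. apply cdiff_const.
        apply cdiff_mult. apply cdiff_const. apply cdiff_id. }
      assert (HA1 : forall z, cdiff (fun z => - (1) * A z)%C z).
      { intros z. apply cdiff_mult. apply cdiff_const. apply HA. }
      assert (HI : rect_integral F x (x + s * (b - a)) y (y + s * (d - c)) =
                   rect_integral E x (x + s * (b - a)) y (y + s * (d - c))).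
      { unfold E. rewrite rect_integral_plus; [|lra|lra| |].
        - rewrite rect_integral_scal; [|lra|lra|]. unfold A. rewrite rect_integral_affine by lra. ring.
          intros z _. apply cdiff_ccont, HA.
        - intros z [[Z1 Z2] _]. apply Hcont. unfold rect; lra.
        - intros z _. apply cdiff_ccont, HA1. }
      rewrite HI.
      apply Rle_trans with (4 * (e * (s * (l + 1))) *
         ((x + s * (b - a) - x) + (y + s * (d - c) - y))).
      + apply rect_integral_bound; [lra|lra| |].
        * intros z [[Z1 Z2] _]. apply cdiff_ccont. apply cdiff_plus.
          apply HF. unfold rect; lra. apply HA1.
        * intros z [[Z1 Z2] _].
          assert (Hz : Cmod (z - (p, q))%C <= s * (l + 1)).
          { destruct z as [zx zy]; simpl in *.
            replace ((zx, zy) - (p, q))%C with (RtoC (zx - p) + Ci * RtoC (zy - q))%C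
              by (apply injective_projections; simpl; ring).
            eapply Rle_trans. apply Cmod_triangle. rewrite Cmod_mult, Cmod_Ci, !Cmod_R.
            assert (Rabs (zx - p) <= s * (b - a)) by (apply Rabs_le; lra).
            assert (Rabs (zy - q) <= s * (d - c)) by (apply Rabs_le; lra).
            unfold l. lra. }
          replace (E z) with (F z - F (p, q) - m * (z - (p, q)))%C by (unfold E, A; ring).
          eapply Rle_trans. apply H. lra. apply Rmult_le_compat_l; lra.
      + replace (x + s * (b - a) - x + (y + s * (d - c) - y)) with (s * l) by (unfold l; ring).
        apply Rle_trans with (4 * (e * (s * (l + 1))) * (s * (l + 1))).
        * apply Rmult_le_compat_l.
          apply Rmult_le_pos. lra. apply Rmult_le_pos. lra. apply Rmult_le_pos; lra.
          apply Rmult_le_compat_l; lra.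
        * right. unfold e. field. lra. }
  unfold P in HP. rewrite !Rmult_1_l, Rmult_1_r in HP.
  replace (a + (b - a)) with b in HP by ring.
  replace (c + (d - c)) with d in HP by ring. exact HP.
Qed.

(** * Cauchy's formula *)

Definition rect_int (a b c d : R) (z : C) : Prop := a < Re z < b /\ c < Im z < d.

(** Continuity bounds [F] near [p], so a small square around [p] contributes arbitrarily little, and
    the four rectangles surrounding that square contribute nothing. *)
Lemma goursat_punctured (F : C -> C) (a b c d : R) (p : C) :
  rect_int a b c d p -> ccont F p ->
  (forall z, rect a b c d z -> z <> p -> cdiff F z) -> rect_integral F a b c d = 0.
Proof.
  intros [Hp1 Hp2] Hcp HF. apply Cmod_eq_0. apply Rle_antisym; [|apply Cmod_ge_0].
  apply le_epsilon. intros eps Heps. rewrite Rplus_0_l.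
  destruct (Hcp 1 Rlt_0_1) as [d0 [Hd0 H0]].
  set (M := Cmod (F p) + 1).
  assert (HM : 0 < M) by (unfold M; assert (X := Cmod_ge_0 (F p)); lra).
  set (m1 := Rmin (Re p - a) (b - Re p)). set (m2 := Rmin (Im p - c) (d - Im p)).
  (* The square around [p] has side [e], so its integral is at most
     [4 * M * (2 * e) = 8 * M * e <= eps / 2]; the other bounds keep it inside the rectangle and
     within [d0] of [p]. *)
  set (e := Rmin (Rmin m1 m2) (Rmin (d0 / 2) (eps / (16 * M)))).
  assert (Pe : 0 < e).
  { unfold e, m1, m2. repeat apply Rmin_pos; try lra. apply Rdiv_lt_0_compat; lra. }
  assert (E1 : e <= Re p - a /\ e <= b - Re p /\ e <= Im p - c /\ e <= d - Im p /\ e <= d0 / 2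
     /\ e <= eps / (16 * M)).
  { assert (e <= m1) by (eapply Rle_trans; apply Rmin_l).
    assert (e <= m2) by (eapply Rle_trans; [apply Rmin_l|apply Rmin_r]).
    assert (e <= d0 / 2) by (eapply Rle_trans; [apply Rmin_r|apply Rmin_l]).
    assert (e <= eps / (16 * M)) by (eapply Rle_trans; [apply Rmin_r|apply Rmin_r]).
    assert (X1 := Rmin_l (Re p - a) (b - Re p)). assert (X2 := Rmin_r (Re p - a) (b - Re p)).
    assert (X3 := Rmin_l (Im p - c) (d - Im p)). assert (X4 := Rmin_r (Im p - c) (d - Im p)).
    unfold m1, m2 in *. lra. }
  assert (Hcont : forall z, rect a b c d z -> ccont F z).
  { intros z Hz. destruct (Ceq_dec z p) as [->|Hz']. exact Hcp. apply cdiff_ccont, HF; assumption. }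
  assert (Zero : forall a' b' c' d', a <= a' <= b' -> b' <= b -> c <= c' <= d' -> d' <= d ->
    (b' < Re p \/ Re p < a' \/ d' < Im p \/ Im p < c') -> rect_integral F a' b' c' d' = 0).
  { intros a' b' c' d' Ha Hb Hc Hd Hout. apply goursat; try lra.
    intros z [Z1 Z2]. apply HF. unfold rect; lra. intros ->. lra. }
  assert (Small : Cmod (rect_integral F (Re p - e / 2) (Re p + e / 2) (Im p - e / 2) (Im p + e / 2)) <= eps).
  { apply Rle_trans with (4 * M * ((Re p + e / 2 - (Re p - e / 2)) + (Im p + e / 2 - (Im p - e / 2)))).
    - apply rect_integral_bound; try lra.
      + intros z [[Z1 Z2] _]. apply Hcont. unfold rect; lra.
      + intros z [[Z1 Z2] _].
        assert (Hz : Cmod (z - p)%C < d0).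
        { apply Cmod_coord_lt; unfold Cminus; rewrite ?re_plus, ?im_plus, ?re_opp, ?im_opp;
            apply Rle_lt_trans with (e / 2); try lra; apply Rabs_le; lra. }
        replace (F z) with (F p + (F z - F p))%C by ring.
        eapply Rle_trans. apply Cmod_triangle. specialize (H0 z Hz). unfold M. lra.
    - replace (Re p + e / 2 - (Re p - e / 2) + (Im p + e / 2 - (Im p - e / 2))) with (2 * e) by field.
      apply Rle_trans with (16 * M * e).
      + apply Rle_trans with (8 * (M * e)). right; ring.
        assert (0 < M * e) by (apply Rmult_lt_0_compat; lra). lra.
      + apply Rle_trans with (16 * M * (eps / (16 * M))).
        apply Rmult_le_compat_l; lra. right; field; lra. }
  assert (Hsub : forall a' b' c' d', a <= a' -> b' <= b -> c <= c' -> d' <= d ->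
     forall z, rect_bd a' b' c' d' z -> ccont F z).
  { intros a' b' c' d' ? ? ? ? z [[Z1 Z2] _]. apply Hcont. unfold rect; lra. }
  rewrite (rect_integral_split_x F a (Re p - e / 2) b); [|lra|lra|apply Hsub; lra].
  rewrite (Zero a) by lra.
  rewrite (rect_integral_split_x F _ (Re p + e / 2) b); [|lra|lra|apply Hsub; lra].
  rewrite (Zero (Re p + e / 2)) by lra.
  rewrite (rect_integral_split_y F _ _ c (Im p - e / 2) d); [|lra|lra|apply Hsub; lra].
  rewrite (Zero _ _ c) by lra.
  rewrite (rect_integral_split_y F _ _ _ (Im p + e / 2) d); [|lra|lra|apply Hsub; lra].
  rewrite (Zero _ _ (Im p + e / 2)) by lra.
  rewrite Cplus_0_l, !Cplus_0_r, Cplus_0_l. exact Small.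
Qed.

Lemma rect_bd_neq_int (a b c d : R) (z w : C) :
  rect_bd a b c d z -> rect_int a b c d w -> (z - w)%C <> 0.
Proof.
  intros [_ H] [H1 H2] E. apply Ceq_minus in E. subst z. lra.
Qed.

Lemma cdiff_cauchy_kernel (F : C -> C) (w z : C) : cdiff F z -> (z - w)%C <> 0 ->
  cdiff (fun z => F z / (z - w))%C z.
Proof.
  intros HF H. apply (cdiff_div F (fun z => z - w)%C). exact HF.
  apply cdiff_minus. apply cdiff_id. apply cdiff_const. exact H.
Qed.

(** The difference quotient [q] of [F] at [w], completed by the derivative, is continuous at [w], so
    its integral vanishes by [goursat_punctured]. The kernel integral stays an unevaluated factor,
    shown to be nonzero next. *)
Lemma cauchy_formula (F : C -> C) (a b c d : R) (w : C) : rect_int a b c d w ->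
  (forall z, rect a b c d z -> cdiff F z) ->
  rect_integral (fun z => F z / (z - w))%C a b c d = (F w * rect_integral (fun z => 1 / (z - w))%C a b c d)%C.
Proof.
  intros Hw HF.
  destruct (HF w) as [l Hl]. { destruct Hw; split; lra. }
  set (q := fun z => if Ceq_dec z w then l else ((F z - F w) / (z - w))%C).
  assert (Hq : rect_integral q a b c d = 0).
  { apply (goursat_punctured q a b c d w Hw).
    - intros e He. assert (He2 : 0 < e / 2) by lra. destruct (Hl _ He2) as [dl [Hdl H]].
      exists dl. split. exact Hdl. intros z Hz. unfold q.
      destruct (Ceq_dec w w) as [_|N]; [|contradiction].
      destruct (Ceq_dec z w) as [->|Hzw].
      + replace (l - l)%C with (RtoC 0) by ring. rewrite Cmod_0. exact He.
      + assert (Hn : (z - w)%C <> 0) by (apply Cminus_eq_contra; exact Hzw).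
        replace ((F z - F w) / (z - w) - l)%C with ((F z - F w - l * (z - w)) / (z - w))%C by (field; exact Hn).
        rewrite Cmod_div by exact Hn. assert (Hn' := proj1 (Cmod_gt_0 _) Hn).
        specialize (H z Hz). apply Rle_lt_trans with (e / 2); [|lra].
        apply Rle_div_l; assumption.
    - intros z Hz Hzw.
      assert (Hn : (z - w)%C <> 0) by (apply Cminus_eq_contra; exact Hzw).
      apply (cdiff_ext_loc (fun z => (F z - F w) / (z - w))%C q z (Cmod (z - w))).
      + apply Cmod_gt_0. exact Hn.
      + intros u Hu. unfold q. destruct (Ceq_dec u w) as [->|]; [|reflexivity].
        rewrite Cmod_sub_comm in Hu. lra.
      + apply (cdiff_cauchy_kernel (fun z => F z - F w)%C). 2: exact Hn.
        apply cdiff_minus. apply HF; exact Hz. apply cdiff_const. }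
  assert (K : forall z, rect_bd a b c d z -> ccont (fun z => 1 / (z - w))%C z).
  { intros z Hz. apply cdiff_ccont. apply (cdiff_cauchy_kernel (fun _ => RtoC 1)).
    apply cdiff_const. apply (rect_bd_neq_int a b c d); assumption. }
  destruct Hw as [Hw1 Hw2].
  rewrite (rect_integral_ext _ (fun z => q z + F w * (1 / (z - w)))%C); try lra.
  - rewrite rect_integral_plus; try lra.
    + rewrite rect_integral_scal; try lra. rewrite Hq. ring. exact K.
    + intros z Hz. apply cdiff_ccont.
      assert (Hn := rect_bd_neq_int a b c d z w Hz (conj Hw1 Hw2)).
      apply (cdiff_ext_loc (fun z => (F z - F w) / (z - w))%C q z (Cmod (z - w))).
      * apply Cmod_gt_0. exact Hn.
      * intros u Hu. unfold q. destruct (Ceq_dec u w) as [->|]; [|reflexivity].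
        rewrite Cmod_sub_comm in Hu. lra.
      * apply (cdiff_cauchy_kernel (fun z => F z - F w)%C). 2: exact Hn.
        apply cdiff_minus. apply HF; apply Hz. apply cdiff_const.
    + intros z Hz. apply cdiff_ccont. apply cdiff_mult. apply cdiff_const.
      apply (cdiff_cauchy_kernel (fun _ => RtoC 1)). apply cdiff_const.
      apply (rect_bd_neq_int a b c d). exact Hz. split; assumption.
  - intros z Hz. assert (Hn := rect_bd_neq_int a b c d z w Hz (conj Hw1 Hw2)).
    unfold q. destruct (Ceq_dec z w) as [->|].
    + exfalso; apply Hn; ring.
    + field. exact Hn.
Qed.

(* Each of the four sides contributes a positive amount to the increment of the argument. *)
Lemma rect_integral_kernel_neq_0 (a b c d : R) (w : C) : rect_int a b c d w ->
  rect_integral (fun z => 1 / (z - w))%C a b c d <> 0.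
Proof.
  intros Hw E. assert (Hw' := Hw). destruct Hw' as [[W1 W2] [W3 W4]].
  set (F := fun z => (1 / (z - w))%C) in *.
  destruct (rect_bd_paths F a b c d) as [F1 [F2 [F3 F4]]]; try lra.
  { intros z Hz. apply cdiff_ccont. apply (cdiff_cauchy_kernel (fun _ => RtoC 1)).
    apply cdiff_const. apply (rect_bd_neq_int a b c d); assumption. }
  assert (PX : forall x y, x - Re w <> 0 \/ y - Im w <> 0 -> 0 < (x - Re w) ^ 2 + (y - Im w) ^ 2).
  { intros x y [H|H].
    - apply Rplus_lt_le_0_compat. apply pow2_gt_0; exact H. apply pow2_ge_0.
    - apply Rplus_le_lt_0_compat. apply pow2_ge_0. apply pow2_gt_0; exact H. }
  assert (FR : forall x y, Re (F (x, y)) = (x - Re w) / ((x - Re w) ^ 2 + (y - Im w) ^ 2)).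
  { intros x y. unfold F. destruct w as [p q]. unfold Re, Im. simpl. unfold Rminus, Rdiv. ring. }
  assert (FI : forall x y, Im (F (x, y)) = (Im w - y) / ((x - Re w) ^ 2 + (y - Im w) ^ 2)).
  { intros x y. unfold F. destruct w as [p q]. unfold Re, Im. simpl. unfold Rminus, Rdiv. ring. }
  apply (f_equal Im) in E. rewrite im_rect_integral, im_RtoC in E. clearbody F.
  assert (I1 : 0 < RInt (fun t => Im (F (t, c))) a b).
  { apply RInt_gt_0. lra.
    - intros t Ht. rewrite FI. apply Rdiv_lt_0_compat. lra. apply PX. right; lra.
    - intros t Ht. exact (proj2 (F1 t Ht)). }
  assert (I2 : 0 < RInt (fun t => Re (F (b, t))) c d).
  { apply RInt_gt_0. lra.
    - intros t Ht. rewrite FR. apply Rdiv_lt_0_compat. lra. apply PX. left; lra.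
    - intros t Ht. exact (proj1 (F4 t Ht)). }
  assert (I3 : 0 < - RInt (fun t => Im (F (t, d))) a b).
  { assert (X := RInt_opp (V := R_CompleteNormedModule) (fun t => Im (F (t, d))) a b).
    change (- RInt (fun t => Im (F (t, d))) a b) with (opp (RInt (fun t => Im (F (t, d))) a b)).
    rewrite <- X.
    2: { apply path_cont_on_ex_RInt in F2; [apply F2|lra]. }
    apply RInt_gt_0. lra.
    - intros t Ht. rewrite FI. match goal with |- 0 < opp ?x => change (opp x) with (- x) end.
      replace (- ((Im w - d) / ((t - Re w) ^ 2 + (d - Im w) ^ 2))) with
         ((d - Im w) / ((t - Re w) ^ 2 + (d - Im w) ^ 2)) by (unfold Rdiv; ring).
      apply Rdiv_lt_0_compat. lra. apply PX. right; lra.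
    - intros t Ht. apply (continuous_opp (V := R_NormedModule)). exact (proj2 (F2 t Ht)). }
  assert (I4 : 0 < - RInt (fun t => Re (F (a, t))) c d).
  { assert (X := RInt_opp (V := R_CompleteNormedModule) (fun t => Re (F (a, t))) c d).
    change (- RInt (fun t => Re (F (a, t))) c d) with (opp (RInt (fun t => Re (F (a, t))) c d)).
    rewrite <- X.
    2: { apply path_cont_on_ex_RInt in F3; [apply F3|lra]. }
    apply RInt_gt_0. lra.
    - intros t Ht. rewrite FR. match goal with |- 0 < opp ?x => change (opp x) with (- x) end.
      replace (- ((a - Re w) / ((a - Re w) ^ 2 + (t - Im w) ^ 2))) with
         ((Re w - a) / ((a - Re w) ^ 2 + (t - Im w) ^ 2)) by (unfold Rdiv; ring).
      apply Rdiv_lt_0_compat. lra. apply PX. left; lra.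
    - intros t Ht. apply (continuous_opp (V := R_NormedModule)). exact (proj1 (F3 t Ht)). }
  lra.
Qed.

Lemma rect_int_dist (a b c d : R) (w : C) : rect_int a b c d w ->
  exists m, 0 < m /\ forall z, rect_bd a b c d z -> m <= Cmod (z - w)%C.
Proof.
  intros [W1 W2].
  exists (Rmin (Rmin (Re w - a) (b - Re w)) (Rmin (Im w - c) (d - Im w))).
  split. repeat apply Rmin_pos; lra.
  intros z [_ Hz].
  assert (A1 := re_le_Cmod (z - w)%C). assert (A2 := im_le_Cmod (z - w)%C).
  unfold Cminus in *. rewrite re_plus, re_opp in A1. rewrite im_plus, im_opp in A2.
  assert (X1 := Rmin_l (Rmin (Re w - a) (b - Re w)) (Rmin (Im w - c) (d - Im w))).
  assert (X2 := Rmin_r (Rmin (Re w - a) (b - Re w)) (Rmin (Im w - c) (d - Im w))).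
  assert (Y1 := Rmin_l (Re w - a) (b - Re w)). assert (Y2 := Rmin_r (Re w - a) (b - Re w)).
  assert (Y3 := Rmin_l (Im w - c) (d - Im w)). assert (Y4 := Rmin_r (Im w - c) (d - Im w)).
  destruct Hz as [E | [E | [E | E]]]; rewrite E in *.
  - rewrite Rabs_left1 in A1 by lra. lra.
  - rewrite Rabs_pos_eq in A1 by lra. lra.
  - rewrite Rabs_left1 in A2 by lra. lra.
  - rewrite Rabs_pos_eq in A2 by lra. lra.
Qed.

(** [K] is quantified before [F]: it depends only on the rectangle and on [w], so one value serves
    all powers of a function. *)
Lemma cauchy_bound (a b c d : R) (w : C) : rect_int a b c d w ->
  exists K, 0 < K /\ forall (F : C -> C) M,
    (forall z, rect a b c d z -> cdiff F z) ->
    (forall z, rect_bd a b c d z -> Cmod (F z) <= M) -> Cmod (F w) <= K * M.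
Proof.
  intros Hw. destruct (rect_int_dist _ _ _ _ _ Hw) as [m [Hm H]].
  set (k := rect_integral (fun z => 1 / (z - w))%C a b c d).
  assert (Hk : 0 < Cmod k) by (apply Cmod_gt_0, rect_integral_kernel_neq_0, Hw).
  assert (Hw' := Hw). destruct Hw' as [[W1 W2] [W3 W4]].
  exists (4 * / m * ((b - a) + (d - c)) / Cmod k). split.
  { apply Rdiv_lt_0_compat; [|exact Hk]. apply Rmult_lt_0_compat; [|lra].
    apply Rmult_lt_0_compat. lra. apply Rinv_0_lt_compat; exact Hm. }
  intros F M HF HM.
  assert (B : Cmod (F w) * Cmod k <= 4 * (M * / m) * ((b - a) + (d - c))).
  { rewrite <- Cmod_mult. unfold k. rewrite <- cauchy_formula by assumption.
    apply rect_integral_bound; try lra.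
    - intros z Hz. apply cdiff_ccont. apply cdiff_cauchy_kernel. apply HF, Hz.
      apply (rect_bd_neq_int a b c d); assumption.
    - intros z Hz. assert (Hn := rect_bd_neq_int a b c d z w Hz Hw).
      rewrite Cmod_div by exact Hn. apply Rmult_le_compat. apply Cmod_ge_0.
      left; apply Rinv_0_lt_compat, Cmod_gt_0, Hn. apply HM, Hz.
      apply Rinv_le_contravar. exact Hm. apply H, Hz. }
  apply Rmult_le_reg_r with (Cmod k). exact Hk.
  eapply Rle_trans. exact B. right. field. lra.
Qed.

(** * Maximum principle and difference quotients *)

(** If [x > M > 0], Bernoulli's inequality [poly] makes [(x / M) ^ n] exceed [K]; for [M = 0] the
    exponent 1 decides. *)
Lemma le_of_pow_le (x M K : R) : 0 <= x -> 0 <= M ->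
  (forall n, x ^ n <= K * M ^ n) -> x <= M.
Proof.
  intros Hx HM H. apply Rnot_lt_le. intros Hlt.
  destruct (Req_dec M 0) as [->|HM0].
  - specialize (H 1%nat). simpl in H. lra.
  - set (t := x / M - 1).
    assert (Ht : 0 < t). { unfold t. apply Rlt_0_minus, Rlt_div_r; lra. }
    destruct (INR_unbounded (K / t)) as [n Hn].
    assert (B := poly n t Ht). specialize (H n).
    assert (E : x ^ n = (1 + t) ^ n * M ^ n).
    { rewrite <- Rpow_mult_distr. f_equal. unfold t. field. exact HM0. }
    rewrite E in H. apply Rmult_le_reg_r in H. 2: apply pow_lt; lra.
    apply Rlt_div_l in Hn. lra. exact Ht.
Qed.

Lemma rect_cases (a b c d : R) (z : C) :
  rect a b c d z -> rect_bd a b c d z \/ rect_int a b c d z.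
Proof.
  intros [H1 H2]. unfold rect_bd, rect_int, rect.
  destruct (Req_dec (Re z) a), (Req_dec (Re z) b), (Req_dec (Im z) c), (Req_dec (Im z) d);
    try (left; split; [split; assumption|tauto]).
  right; lra.
Qed.

(* Cauchy's bound for [F ^ n] has a constant independent of [n], so n-th roots remove it. *)
Lemma max_modulus (F : C -> C) (a b c d M : R) (w : C) : 0 <= M ->
  (forall z, rect a b c d z -> cdiff F z) ->
  (forall z, rect_bd a b c d z -> Cmod (F z) <= M) ->
  rect a b c d w -> Cmod (F w) <= M.
Proof.
  intros HM HF HB Hw. destruct (rect_cases _ _ _ _ _ Hw) as [Hb|Hi].
  - apply HB, Hb.
  - destruct (cauchy_bound _ _ _ _ _ Hi) as [K [HK H]].
    apply (le_of_pow_le _ _ K). apply Cmod_ge_0. exact HM.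
    intros n. rewrite <- Cmod_pow.
    apply (H (fun z => F z ^ n)%C (M ^ n)).
    + intros z Hz. apply cdiff_pow, HF, Hz.
    + intros z Hz. rewrite Cmod_pow. apply pow_incr. split. apply Cmod_ge_0. apply HB, Hz.
Qed.

Lemma path_bounded (g : R -> C) (a b : R) : path_cont_on g a b ->
  exists M, forall t, a <= t <= b -> Cmod (g t) <= M.
Proof.
  intros H.
  destruct (bounded_continuity (V := R_NormedModule) (fun t => Re (g t)) a b) as [M1 H1].
  { intros t Ht. apply (H t Ht). }
  destruct (bounded_continuity (V := R_NormedModule) (fun t => Im (g t)) a b) as [M2 H2].
  { intros t Ht. apply (H t Ht). }
  exists (M1 + M2). intros t Ht. specialize (H1 t Ht). specialize (H2 t Ht).
  change (Rabs (Re (g t)) < M1) in H1. change (Rabs (Im (g t)) < M2) in H2.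
  replace (g t) with (RtoC (Re (g t)) + Ci * RtoC (Im (g t)))%C
    by (apply injective_projections; simpl; unfold Re, Im; ring).
  eapply Rle_trans. apply Cmod_triangle. rewrite Cmod_mult, Cmod_Ci, !Cmod_R. lra.
Qed.

Lemma rect_bd_bounded (F : C -> C) (a b c d : R) : a <= b -> c <= d ->
  (forall z, rect_bd a b c d z -> ccont F z) ->
  exists M, 0 <= M /\ forall z, rect_bd a b c d z -> Cmod (F z) <= M.
Proof.
  intros Hab Hcd H. destruct (rect_bd_paths F a b c d Hab Hcd H) as [F1 [F2 [F3 F4]]].
  destruct (path_bounded _ _ _ F1) as [M1 H1]. destruct (path_bounded _ _ _ F2) as [M2 H2].
  destruct (path_bounded _ _ _ F3) as [M3 H3]. destruct (path_bounded _ _ _ F4) as [M4 H4].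
  assert (P1 := Rle_trans _ _ _ (Cmod_ge_0 _) (H1 a (conj (Rle_refl a) Hab))).
  assert (P2 := Rle_trans _ _ _ (Cmod_ge_0 _) (H2 a (conj (Rle_refl a) Hab))).
  assert (P3 := Rle_trans _ _ _ (Cmod_ge_0 _) (H3 c (conj (Rle_refl c) Hcd))).
  assert (P4 := Rle_trans _ _ _ (Cmod_ge_0 _) (H4 c (conj (Rle_refl c) Hcd))).
  exists (M1 + M2 + M3 + M4). split. lra.
  intros [x y] [[Z1 Z2] Z3]. simpl in *.
  destruct Z3 as [E | [E | [E | E]]]; subst.
  - specialize (H3 y Z2). lra.
  - specialize (H4 y Z2). lra.
  - specialize (H1 x Z1). lra.
  - specialize (H2 x Z1). lra.
Qed.

(** Differentiation under the integral sign through the exact identity 1/(z-v) = 1/(z-w) +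
    (v-w)/(z-w)^2 + (v-w)^2/((z-w)^2 (z-v)), whose last term is a quadratic remainder. *)
Lemma cauchy_transform_cdiff (F : C -> C) (a b c d : R) (w : C) : rect_int a b c d w ->
  (forall z, rect_bd a b c d z -> cdiff F z) ->
  cdiff (fun w => rect_integral (fun z => F z / (z - w))%C a b c d) w.
Proof.
  intros Hw HF. destruct (rect_int_dist _ _ _ _ _ Hw) as [m [Hm Hd]].
  assert (Hw' := Hw). destruct Hw' as [[W1 W2] [W3 W4]].
  destruct (rect_bd_bounded F a b c d) as [M [PM HM]]; try lra.
  { intros z Hz. apply cdiff_ccont, HF, Hz. }
  assert (K0 : forall z, rect_bd a b c d z -> (z - w)%C <> 0)
    by (intros z Hz; apply (rect_bd_neq_int a b c d); assumption).
  assert (D1 : forall z, rect_bd a b c d z -> cdiff (fun z => F z / (z - w))%C z).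
  { intros z Hz. apply cdiff_cauchy_kernel. apply HF, Hz. apply K0, Hz. }
  assert (D2 : forall z, rect_bd a b c d z -> cdiff (fun z => F z / (z - w) / (z - w))%C z).
  { intros z Hz. apply (cdiff_cauchy_kernel (fun z => F z / (z - w))%C).
    apply D1, Hz. apply K0, Hz. }
  exists (rect_integral (fun z => F z / (z - w) / (z - w))%C a b c d).
  (* Bounds the integral in the remainder: [Cmod (F z) <= M], [Cmod (z - w) >= m], and
     [Cmod (z - v) >= m / 2] once [v] is within [m / 2] of [w]. *)
  set (N := 4 * (M / (m * m * (m / 2))) * ((b - a) + (d - c))).
  assert (PN : 0 <= N).
  { unfold N. apply Rmult_le_pos; [|lra]. apply Rmult_le_pos. lra.
    apply Rdiv_le_0_compat. exact PM. repeat apply Rmult_lt_0_compat; lra. }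
  intros e He. exists (Rmin (m / 2) (e / (N + 1))). split.
  { apply Rmin_pos. lra. apply Rdiv_lt_0_compat; lra. }
  intros v Hv.
  assert (V1 := Rlt_le_trans _ _ _ Hv (Rmin_l _ _)).
  assert (V2 := Rlt_le_trans _ _ _ Hv (Rmin_r _ _)).
  assert (Kv : forall z, rect_bd a b c d z -> m / 2 <= Cmod (z - v)%C).
  { intros z Hz. specialize (Hd z Hz).
    replace (z - w)%C with ((z - v) + (v - w))%C in Hd by ring.
    assert (T := Cmod_triangle (z - v) (v - w)). lra. }
  assert (Kv0 : forall z, rect_bd a b c d z -> (z - v)%C <> 0).
  { intros z Hz. apply Cmod_gt_0. specialize (Kv z Hz). lra. }
  assert (D3 : forall z, rect_bd a b c d z ->
     cdiff (fun z => F z / (z - w) / (z - w) / (z - v))%C z).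
  { intros z Hz. apply (cdiff_cauchy_kernel (fun z => F z / (z - w) / (z - w))%C).
    apply D2, Hz. apply Kv0, Hz. }
  assert (E : (rect_integral (fun z => F z / (z - v)) a b c d - rect_integral (fun z => F z / (z - w)) a b c d
     - rect_integral (fun z => F z / (z - w) / (z - w)) a b c d * (v - w) =
     (v - w) * (v - w) * rect_integral (fun z => F z / (z - w) / (z - w) / (z - v)) a b c d)%C).
  { rewrite (rect_integral_ext (fun z => F z / (z - v))%C
      (fun z => F z / (z - w) + ((v - w) * (F z / (z - w) / (z - w)) +
         ((v - w) * (v - w)) * (F z / (z - w) / (z - w) / (z - v))))%C); try lra.
    - rewrite rect_integral_plus; try lra.
      + rewrite rect_integral_plus; try lra.
        * rewrite !rect_integral_scal; try lra. ring.
          intros z Hz. apply cdiff_ccont, D3, Hz.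
          intros z Hz. apply cdiff_ccont, D2, Hz.
        * intros z Hz. apply cdiff_ccont, cdiff_mult. apply cdiff_const. apply D2, Hz.
        * intros z Hz. apply cdiff_ccont, cdiff_mult. apply cdiff_const. apply D3, Hz.
      + intros z Hz. apply cdiff_ccont, D1, Hz.
      + intros z Hz. apply cdiff_ccont, cdiff_plus; (apply cdiff_mult; [apply cdiff_const|]).
        apply D2, Hz. apply D3, Hz.
    - intros z Hz. field. split. apply K0, Hz. apply Kv0, Hz. }
  rewrite E, !Cmod_mult.
  assert (B : Cmod (rect_integral (fun z => F z / (z - w) / (z - w) / (z - v))%C a b c d) <= N).
  { unfold N. apply rect_integral_bound; try lra.
    - intros z Hz. apply cdiff_ccont, D3, Hz.
    - intros z Hz. specialize (HM z Hz). specialize (Hd z Hz).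
      assert (N1 := K0 z Hz). assert (N2 := Kv0 z Hz). specialize (Kv z Hz).
      rewrite !Cmod_div by assumption.
      replace (Cmod (F z) / Cmod (z - w) / Cmod (z - w) / Cmod (z - v)) with
        (Cmod (F z) / (Cmod (z - w) * Cmod (z - w) * Cmod (z - v))) by (field; lra).
      unfold Rdiv at 1 2. apply Rmult_le_compat. apply Cmod_ge_0.
      left; apply Rinv_0_lt_compat; repeat apply Rmult_lt_0_compat; lra.
      exact HM. apply Rinv_le_contravar. repeat apply Rmult_lt_0_compat; lra.
      apply Rmult_le_compat; try lra. apply Rmult_le_pos; lra.
      apply Rmult_le_compat; lra. }
  set (h := Cmod (v - w)%C) in *. assert (Ph : 0 <= h) by apply Cmod_ge_0.
  apply Rle_trans with (h * h * N).
  - apply Rmult_le_compat_l. apply Rmult_le_pos; exact Ph. exact B.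
  - replace (h * h * N) with ((h * N) * h) by ring. apply Rmult_le_compat_r. exact Ph.
    apply Rle_trans with (e / (N + 1) * (N + 1)).
    + apply Rmult_le_compat; lra.
    + right; field; lra.
Qed.

Lemma rect_int_open (a b c d : R) (w : C) : rect_int a b c d w ->
  exists m, 0 < m /\ forall z, Cmod (z - w)%C < m -> rect_int a b c d z.
Proof.
  intros [W1 W2].
  exists (Rmin (Rmin (Re w - a) (b - Re w)) (Rmin (Im w - c) (d - Im w))).
  split. repeat apply Rmin_pos; lra.
  intros z Hz.
  assert (A1 := re_le_Cmod (z - w)%C). assert (A2 := im_le_Cmod (z - w)%C).
  unfold Cminus in A1, A2. rewrite re_plus, re_opp in A1. rewrite im_plus, im_opp in A2.
  fold (z - w)%C in A1, A2.
  assert (X1 := Rmin_l (Rmin (Re w - a) (b - Re w)) (Rmin (Im w - c) (d - Im w))).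
  assert (X2 := Rmin_r (Rmin (Re w - a) (b - Re w)) (Rmin (Im w - c) (d - Im w))).
  assert (Y1 := Rmin_l (Re w - a) (b - Re w)). assert (Y2 := Rmin_r (Re w - a) (b - Re w)).
  assert (Y3 := Rmin_l (Im w - c) (d - Im w)). assert (Y4 := Rmin_r (Im w - c) (d - Im w)).
  assert (B1 := Rle_abs (Re z + - Re w)). assert (B2 := Rle_abs (- (Re z + - Re w))).
  assert (B3 := Rle_abs (Im z + - Im w)). assert (B4 := Rle_abs (- (Im z + - Im w))).
  rewrite Rabs_Ropp in B2, B4. unfold rect_int. lra.
Qed.

(** Removable singularity at [w]: there [g] takes the value of a quotient of Cauchy transforms, and
    Cauchy's formula shows that [g] equals this quotient on a whole neighborhood of [w]. The
    factorization holds for every [z] and [g] is differentiable wherever [F] is, so division by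
    zeros can be iterated on the same rectangle. *)
Lemma difference_quotient_cdiff (F : C -> C) (a b c d : R) (w : C) : rect_int a b c d w ->
  (forall z, rect a b c d z -> cdiff F z) ->
  exists g, (forall z, F z = (F w + (z - w) * g z)%C) /\ (forall z, cdiff F z -> cdiff g z).
Proof.
  intros Hw HF.
  assert (Hw' := Hw). destruct Hw' as [[W1 W2] [W3 W4]].
  set (T1 := fun v => rect_integral (fun z => 1 / (z - v))%C a b c d).
  set (Tq := fun v => rect_integral (fun z => (F z - F w) / (z - w) / (z - v))%C a b c d).
  set (g := fun z => if Ceq_dec z w then (Tq w / T1 w)%C else ((F z - F w) / (z - w))%C).
  exists g. split.
  { intros z. unfold g. destruct (Ceq_dec z w) as [->|Hz].
    - ring.
    - field. apply Cminus_eq_contra, Hz. }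
  intros z Hz. destruct (Ceq_dec z w) as [->|Hzw].
  2: { assert (Hn : (z - w)%C <> 0) by (apply Cminus_eq_contra; exact Hzw).
    apply (cdiff_ext_loc (fun z => (F z - F w) / (z - w))%C g z (Cmod (z - w))).
    - apply Cmod_gt_0. exact Hn.
    - intros u Hu. unfold g. destruct (Ceq_dec u w) as [->|]; [|reflexivity].
      rewrite Cmod_sub_comm in Hu. lra.
    - apply (cdiff_cauchy_kernel (fun z => F z - F w)%C). 2: exact Hn.
      apply cdiff_minus. exact Hz. apply cdiff_const. }
  assert (DF : forall u, rect a b c d u -> cdiff (fun z => F z - F w)%C u).
  { intros u Hu. apply cdiff_minus. apply HF, Hu. apply cdiff_const. }
  assert (Dq : forall u, rect_bd a b c d u -> cdiff (fun z => (F z - F w) / (z - w))%C u).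
  { intros u Hu. apply (cdiff_cauchy_kernel (fun z => F z - F w)%C). apply DF, Hu.
    apply (rect_bd_neq_int a b c d); assumption. }
  destruct (rect_int_open _ _ _ _ _ Hw) as [m [Hm Hopen]].
  apply (cdiff_ext_loc (fun v => Tq v / T1 v)%C g w m Hm).
  - intros v Hv. specialize (Hopen v Hv). unfold g.
    destruct (Ceq_dec v w) as [->|Hvw]; [reflexivity|].
    assert (Hn : (v - w)%C <> 0) by (apply Cminus_eq_contra; exact Hvw).
    assert (HT : T1 v <> 0) by (exact (rect_integral_kernel_neq_0 a b c d v Hopen)).
    assert (C1 := cauchy_formula (fun z => F z - F w)%C a b c d v Hopen DF).
    assert (C2 := cauchy_formula (fun z => F z - F w)%C a b c d w Hw DF).
    simpl in C1, C2. fold (T1 v) in C1. fold (T1 w) in C2.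
    (* [F - F w] vanishes at [w], so its integral against [1 / (z - w)] is 0. In the partial
       fractions 1/(z-v) = 1/(z-w) + (v-w)/((z-w)(z-v)) only the second term survives. *)
    replace (F w - F w)%C with (RtoC 0) in C2 by ring. rewrite Cmult_0_l in C2.
    assert (E : rect_integral (fun z => (F z - F w) / (z - v))%C a b c d = ((v - w) * Tq v)%C).
    { rewrite (rect_integral_ext _ (fun z => (F z - F w) / (z - w) +
          (v - w) * ((F z - F w) / (z - w) / (z - v)))%C); try lra.
      - rewrite rect_integral_plus; try lra.
        + rewrite C2, rect_integral_scal; try lra. unfold Tq. ring.
          intros u Hu. apply cdiff_ccont, (cdiff_cauchy_kernel (fun z => (F z - F w) / (z - w))%C).
          apply Dq, Hu. apply (rect_bd_neq_int a b c d); assumption.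
        + intros u Hu. apply cdiff_ccont, Dq, Hu.
        + intros u Hu. apply cdiff_ccont, cdiff_mult. apply cdiff_const.
          apply (cdiff_cauchy_kernel (fun z => (F z - F w) / (z - w))%C).
          apply Dq, Hu. apply (rect_bd_neq_int a b c d); assumption.
      - intros u Hu. field. split; apply (rect_bd_neq_int a b c d); assumption. }
    rewrite E in C1.
    replace (Tq v) with ((v - w) * Tq v / (v - w))%C by (field; exact Hn).
    rewrite C1. field. split; assumption.
  - apply (cdiff_div Tq T1).
    + exact (cauchy_transform_cdiff (fun z => (F z - F w) / (z - w))%C a b c d w Hw Dq).
    + exact (cauchy_transform_cdiff (fun z => RtoC 1) a b c d w Hw (fun z _ => cdiff_const 1 z)).
    + exact (rect_integral_kernel_neq_0 a b c d w Hw).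
Qed.

(** * Growth near the center *)

(** The maximum principle for [F * Cexp (- G)]. Here [Re G + ln M] acts as a harmonic majorant of
    log |F|, which lets holomorphic functions stand in for subharmonic ones. *)
Lemma weighted_max_modulus (F G : C -> C) (a b c d M : R) (w : C) : 0 <= M ->
  (forall z, rect a b c d z -> cdiff F z) ->
  (forall z, rect a b c d z -> cdiff G z) ->
  (forall z, rect_bd a b c d z -> Cmod (F z) <= M * exp (Re (G z))) ->
  rect a b c d w -> Cmod (F w) <= M * exp (Re (G w)).
Proof.
  intros HM HF HG HB Hw.
  assert (H : Cmod (F w * Cexp (0 - G w))%C <= M).
  { apply (max_modulus (fun z => F z * Cexp (0 - G z))%C a b c d M w HM); [| |exact Hw].
    - intros z Hz. apply cdiff_mult. apply HF, Hz.
      apply cdiff_Cexp, cdiff_minus. apply cdiff_const. apply HG, Hz.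
    - intros z Hz. rewrite Cmod_mult, Cmod_Cexp. specialize (HB z Hz).
      unfold Cminus. rewrite re_plus, re_opp, re_RtoC, Rplus_0_l, exp_Ropp.
      apply (Rmult_le_compat_r (/ exp (Re (G z)))) in HB.
      2: { left; apply Rinv_0_lt_compat, exp_pos. }
      rewrite Rmult_assoc, Rinv_r, Rmult_1_r in HB. exact HB.
      apply Rgt_not_eq, exp_pos. }
  rewrite Cmod_mult, Cmod_Cexp in H. unfold Cminus in H.
  rewrite re_plus, re_opp, re_RtoC, Rplus_0_l, exp_Ropp in H.
  apply (Rmult_le_compat_r (exp (Re (G w)))) in H. 2: { left; apply exp_pos. }
  rewrite Rmult_assoc, Rinv_l, Rmult_1_r in H. exact H.
  apply Rgt_not_eq, exp_pos.
Qed.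

Lemma exp_le_compat (x y : R) : x <= y -> exp x <= exp y.
Proof.
  intros [H|H]. left; apply exp_increasing, H. rewrite H; apply Rle_refl.
Qed.

Lemma cosh_ge_half_exp (t : R) : exp t / 2 <= cosh t.
Proof. unfold cosh. assert (H := exp_pos (- t)). lra. Qed.

Lemma cosh_le_exp_abs (t : R) : cosh t <= exp (Rabs t).
Proof.
  unfold cosh. assert (H1 := exp_le_compat _ _ (Rle_abs t)).
  assert (H2 := exp_le_compat _ _ (Rle_abs (- t))). rewrite Rabs_Ropp in H2. lra.
Qed.

Lemma cosh_le_compat (s t : R) : 0 <= s <= t -> cosh s <= cosh t.
Proof.
  intros [Hs Hst]. unfold cosh. rewrite !exp_Ropp.
  assert (E1 : 1 <= exp s) by (rewrite <- exp_0; apply exp_le_compat; lra).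
  assert (E2 := exp_le_compat _ _ Hst).
  set (p := exp s) in *. set (q := exp t) in *.
  assert (H : 0 <= (q - p) * (p * q - 1) / (p * q)).
  { apply Rdiv_le_0_compat. apply Rmult_le_pos. lra. nra. nra. }
  replace ((q - p) * (p * q - 1) / (p * q)) with ((q + / q) - (p + / p)) in H by (field; lra).
  lra.
Qed.

Lemma cosh_even (t : R) : cosh (- t) = cosh t.
Proof. unfold cosh. rewrite Ropp_involutive. lra. Qed.

Lemma cos_ge_half (t : R) : Rabs t <= PI / 4 -> / 2 <= cos t.
Proof.
  intros H. assert (HP := PI_RGT_0).
  destruct (Rle_dec 0 t) as [Ht|Ht].
  - rewrite Rabs_pos_eq in H by lra.
    replace (/ 2) with (cos (PI / 3)) by (rewrite cos_PI3; field).
    apply cos_decr_1; lra.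
  - rewrite Rabs_left in H by lra. rewrite <- (cos_neg t).
    replace (/ 2) with (cos (PI / 3)) by (rewrite cos_PI3; field).
    apply cos_decr_1; lra.
Qed.

Definition Ccosh (z : C) : C := ((Cexp z + Cexp (- z)) / 2)%C.

Lemma re_Ccosh (z : C) : Re (Ccosh z) = cosh (Re z) * cos (Im z).
Proof.
  unfold Ccosh, Cexp, cosh. destruct z as [p q]. simpl. rewrite cos_neg. field.
Qed.

Lemma cdiff_Ccosh (f : C -> C) (z : C) : cdiff f z -> cdiff (fun w => Ccosh (f w)) z.
Proof.
  intros H. unfold Ccosh.
  apply (cdiff_mult (fun w => Cexp (f w) + Cexp (- f w))%C (fun _ => / 2)%C).
  2: apply cdiff_const.
  apply cdiff_plus; apply cdiff_Cexp. exact H.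
  apply (cdiff_ext_loc (fun w => 0 - f w)%C _ z 1 Rlt_0_1). intros; ring.
  apply cdiff_minus. apply cdiff_const. exact H.
Qed.

Lemma C_pair (x y : R) : (RtoC x + Ci * RtoC y)%C = (x, y).
Proof. apply injective_projections; simpl; ring. Qed.

(* The weight is 4 exp(-al L/2) cosh(al (z - x0 - i y0/2)) - i lambda z with al = PI/(2 y0):
   its real part is at least lambda y on the horizontal edges, and cos >= 1/2 together
   with cosh(al X) >= exp(al L)/2 gives the required size on the vertical ones. *)
Lemma bound_near_center (a b y0 : R) (f : C -> C) (A lambda L x0 : R) :
  0 < y0 -> 0 < A -> 0 < L ->
  (forall z, rect a b 0 y0 z -> cdiff f z) ->
  (forall x, a <= x <= b -> Cmod (f (x, 0)) <= A) ->
  (forall x, a <= x <= b -> Cmod (f (x, y0)) <= A * exp (lambda * y0)) ->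
  (forall x y, x = a \/ x = b -> 0 <= y <= y0 ->
     Cmod (f (x, y)) <= A * exp (lambda * y + exp (PI * L / (4 * y0)))) ->
  a + L <= x0 <= b - L ->
  forall x y, Rabs (x - x0) <= Rmin y0 L -> 0 <= y <= y0 ->
    Cmod (f (x, y)) <= A * exp (lambda * y + 12).
Proof.
  intros Hy0 HA HL Hf Hlow Hup Hver Hx0 x y Hx Hy.
  assert (HP := PI_RGT_0). assert (HP4 := PI_4).
  (* With this frequency [al * (q - y0 / 2)] stays within PI/4 of 0 for [0 <= q <= y0], where the
     cosine is at least 1/2. *)
  set (al := PI / (2 * y0)).
  assert (Hal : 0 < al) by (apply Rdiv_lt_0_compat; lra).
  assert (Haly : al * y0 = PI / 2) by (unfold al; field; lra).
  set (ka := 4 * exp (- (al * L / 2))).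
  assert (Hka : 0 < ka) by (apply Rmult_lt_0_compat; [lra|apply exp_pos]).
  set (G := fun z : C => (ka * Ccosh (al * (z - (x0, (y0 / 2)%R))) + - Ci * lambda * z)%C).
  assert (ReG : forall p q, Re (G (p, q)) =
    ka * (cosh (al * (p - x0)) * cos (al * (q - y0 / 2))) + lambda * q).
  { intros p q. unfold G. rewrite re_plus, re_scal_l, re_Ccosh.
    rewrite re_scal_l, im_scal_l. unfold Cminus. rewrite re_plus, im_plus, re_opp, im_opp.
    simpl. unfold Rminus. ring. }
  assert (Hcos : forall q, 0 <= q <= y0 -> / 2 <= cos (al * (q - y0 / 2))).
  { intros q Hq. apply cos_ge_half. rewrite Rabs_mult, (Rabs_pos_eq al) by lra.
    replace (PI / 4) with (al * (y0 / 2)) by lra.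
    apply Rmult_le_compat_l. lra. apply Rabs_le; lra. }
  assert (Hcosh0 : forall t, 0 < cosh t).
  { intros t. unfold cosh. assert (X1 := exp_pos t). assert (X2 := exp_pos (- t)). lra. }
  assert (HGlow : forall p q, 0 <= q <= y0 -> lambda * q <= Re (G (p, q))).
  { intros p q Hq. rewrite ReG. specialize (Hcos q Hq).
    assert (0 <= ka * (cosh (al * (p - x0)) * cos (al * (q - y0 / 2)))); [|lra].
    apply Rmult_le_pos. lra. apply Rmult_le_pos; [left; apply Hcosh0|lra]. }
  assert (HGver : forall p q, L <= Rabs (p - x0) -> 0 <= q <= y0 ->
     lambda * q + exp (PI * L / (4 * y0)) <= Re (G (p, q))).
  { intros p q Hp Hq. rewrite ReG. specialize (Hcos q Hq).
    assert (C1 : exp (al * L) / 2 <= cosh (al * (p - x0))).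
    { apply Rle_trans with (cosh (al * L)). apply cosh_ge_half_exp.
      replace (cosh (al * (p - x0))) with (cosh (al * Rabs (p - x0))).
      - apply cosh_le_compat. split. apply Rmult_le_pos; lra. apply Rmult_le_compat_l; lra.
      - unfold Rabs. destruct (Rcase_abs (p - x0)). 2: reflexivity.
        rewrite <- cosh_even. f_equal. ring. }
    replace (PI * L / (4 * y0)) with (al * L / 2) by (unfold al; field; lra).
    (* The 4 in [ka] pays for the two halves lost in [cosh >= exp / 2] and [cos >= / 2]. *)
    assert (E : exp (al * L / 2) = ka * (exp (al * L) / 2 * / 2)).
    { unfold ka. replace (al * L) with (al * L / 2 + al * L / 2) at 3 by field.
      rewrite exp_plus, exp_Ropp. field. apply Rgt_not_eq, exp_pos. }
    rewrite E, Rplus_comm. apply Rplus_le_compat_r. apply Rmult_le_compat_l. lra.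
    apply Rmult_le_compat; try lra. assert (X := exp_pos (al * L)). lra. }
  assert (Hx' : Rabs (x - x0) <= y0 /\ Rabs (x - x0) <= L).
  { assert (X1 := Rmin_l y0 L). assert (X2 := Rmin_r y0 L). lra. }
  assert (Main : Cmod (f (x, y)) <= A * exp (Re (G (x, y)))).
  { apply (weighted_max_modulus f G a b 0 y0 A (x, y)). lra. exact Hf.
    - intros z _. apply cdiff_plus.
      + apply (cdiff_mult (fun _ => RtoC ka) (fun z => Ccosh (al * (z - (x0, (y0 / 2)%R))))%C).
        apply cdiff_const. apply cdiff_Ccosh. apply cdiff_mult. apply cdiff_const.
        apply cdiff_minus. apply cdiff_id. apply cdiff_const.
      + apply cdiff_mult. apply cdiff_const. apply cdiff_id.
    - intros [p q] [[Z1 Z2] Z3]. simpl in Z1, Z2, Z3.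
      destruct Z3 as [Z3 | [Z3 | [Z3 | Z3]]].
      + eapply Rle_trans. apply Hver; [left; exact Z3|exact Z2].
        apply Rmult_le_compat_l. lra. apply exp_le_compat, HGver; [|exact Z2].
        rewrite Rabs_left1; lra.
      + eapply Rle_trans. apply Hver; [right; exact Z3|exact Z2].
        apply Rmult_le_compat_l. lra. apply exp_le_compat, HGver; [|exact Z2].
        rewrite Rabs_pos_eq; lra.
      + subst q. eapply Rle_trans. apply Hlow; exact Z1.
        rewrite <- (Rmult_1_r A) at 1. apply Rmult_le_compat_l. lra.
        rewrite <- exp_0. apply exp_le_compat. specialize (HGlow p 0). lra.
      + subst q. eapply Rle_trans. apply Hup; exact Z1.
        apply Rmult_le_compat_l. lra. apply exp_le_compat. apply HGlow; lra.
    - split; simpl. 2: lra.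
      assert (X1 := Rle_abs (x - x0)). assert (X2 := Rle_abs (- (x - x0))).
      rewrite Rabs_Ropp in X2. lra. }
  eapply Rle_trans. exact Main. apply Rmult_le_compat_l. lra. apply exp_le_compat.
  rewrite ReG.
  assert (ka * (cosh (al * (x - x0)) * cos (al * (y - y0 / 2))) <= 12); [|lra].
  apply Rle_trans with (ka * (exp (al * Rabs (x - x0)) * 1)).
  - apply Rmult_le_compat_l. lra. apply Rmult_le_compat.
    left; apply Hcosh0. specialize (Hcos y Hy); lra.
    rewrite <- (Rabs_pos_eq al) at 2 by lra. rewrite <- Rabs_mult. apply cosh_le_exp_abs.
    apply COS_bound.
  - unfold ka. rewrite Rmult_1_r, Rmult_assoc, <- exp_plus.
    (* Since [Rabs (x - x0) <= Rmin y0 L <= (y0 + L) / 2], the exponent is at most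
       [al * y0 / 2 = PI / 4 <= 1]; hence the constant 12 = 4 * 3. *)
    assert (exp (- (al * L / 2) + al * Rabs (x - x0)) <= 3); [|lra].
    apply Rle_trans with (exp 1). 2: apply exp_le_3.
    apply exp_le_compat.
    assert (al * Rabs (x - x0) <= al * ((y0 + L) / 2)) by (apply Rmult_le_compat_l; lra).
    lra.
Qed.

(** * Chebyshev polynomials and the Green function of [-1, 1] *)

Lemma RtoC_neq_0 (x : R) : x <> 0 -> RtoC x <> 0.
Proof. intros H E. apply H. apply RtoC_inj in E. exact E. Qed.

Fixpoint cheb (n : nat) (w : C) : C :=
  match n with
  | O => 1
  | S m => match m with O => w | S k => (2 * w * cheb m w - cheb k w)%C end
  end.

Lemma cheb_SS (n : nat) (w : C) : cheb (S (S n)) w = (2 * w * cheb (S n) w - cheb n w)%C.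
Proof. reflexivity. Qed.

(** For [u = exp(i theta)] this is T_n(cos theta) = cos(n theta); the algebraic form also covers [u]
    off the unit circle. *)
Lemma cheb_joukowski (n : nat) (u : C) : u <> 0 ->
  (2 * cheb n ((u + / u) / 2) = u ^ n + (/ u) ^ n)%C.
Proof.
  intros Hu.
  assert (H : (2 * cheb n ((u + / u) / 2) = u ^ n + (/ u) ^ n)%C /\
    (2 * cheb (S n) ((u + / u) / 2) = u ^ S n + (/ u) ^ S n)%C).
  { induction n as [|n [IH1 IH2]].
    - split; simpl; field. exact Hu.
    - split. exact IH2. rewrite cheb_SS.
      set (w := ((u + / u) / 2)%C) in *.
      replace (2 * (2 * w * cheb (S n) w - cheb n w))%C with
        (2 * w * (2 * cheb (S n) w) - 2 * cheb n w)%C by ring.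
      rewrite IH1, IH2. unfold w. rewrite !Cpow_S.
      replace (u * (u * u ^ n) + / u * (/ u * (/ u) ^ n))%C with
        (2 * ((u + / u) / 2) * (u * u ^ n + / u * (/ u) ^ n) - u * / u * (u ^ n + (/ u) ^ n))%C.
      rewrite Cinv_r by exact Hu. ring. field. exact Hu. }
  apply H.
Qed.

(** A crude bound: if [w = (u + 1/u)/2] with |u| >= 1, then 2|w| + 1 <= 3|u|, so it exceeds the true
    growth rate |u| by a bounded factor. After n-th roots this only adds a constant to the majorant
    on the sides where it is used. *)
Lemma Cmod_cheb_le (n : nat) (w : C) : Cmod (cheb n w) <= (2 * Cmod w + 1) ^ n.
Proof.
  assert (Pw := Cmod_ge_0 w).
  assert (H : Cmod (cheb n w) <= (2 * Cmod w + 1) ^ n /\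
     Cmod (cheb (S n) w) <= (2 * Cmod w + 1) ^ S n).
  { induction n as [|n [IH1 IH2]].
    - split; simpl. rewrite Cmod_1. lra. lra.
    - split. exact IH2. rewrite cheb_SS. unfold Cminus.
      eapply Rle_trans. apply Cmod_triangle. rewrite Cmod_opp, !Cmod_mult, Cmod_R, Rabs_pos_eq by lra.
      set (t := 2 * Cmod w + 1) in *.
      change (t ^ S (S n)) with (t * t ^ S n).
      assert (Ht : t ^ n <= t ^ S n).
      { simpl. assert (0 < t ^ n) by (apply pow_lt; unfold t; lra).
        rewrite <- (Rmult_1_l (t ^ n)) at 1. apply Rmult_le_compat_r. lra. unfold t; lra. }
      replace (t * t ^ S n) with (2 * Cmod w * t ^ S n + t ^ S n) by (unfold t; ring).
      apply Rplus_le_compat. apply Rmult_le_compat_l; lra. lra. }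
  apply H.
Qed.

Lemma Cmod_pow2 (p q : R) : Cmod (p, q) ^ 2 = p ^ 2 + q ^ 2.
Proof. rewrite Cmod2_alt. reflexivity. Qed.

(** For [t] in [-1, 1] the point [u = t + i sqrt(1 - t^2)] lies on the unit circle, so |u^n +
    u^(-n)| <= 2. *)
Lemma Cmod_cheb_interval (n : nat) (t : R) : Rabs t <= 1 -> Cmod (cheb n t) <= 1.
Proof.
  intros Ht. assert (Ht2 : 0 <= 1 - t * t).
  { destruct (proj1 (Rabs_le_between _ _) Ht). nra. }
  set (u := (t, sqrt (1 - t * t)) : C).
  assert (Hs := sqrt_sqrt _ Ht2).
  assert (Hm : Cmod u = 1).
  { apply Rsqr_inj. apply Cmod_ge_0. lra. rewrite !Rsqr_pow2. unfold u. rewrite Cmod_pow2. simpl. lra. }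
  assert (Hu : u <> 0). { apply Cmod_gt_0. lra. }
  assert (Hi : (/ u)%C = Cconj u).
  { replace (Cconj u) with (Cconj u * u * / u)%C by (field; exact Hu).
    rewrite (Cmult_comm (Cconj u)), <- Cmod2_conj, Hm. simpl.
    replace (1 * (1 * 1)) with 1 by ring. ring. }
  assert (E := cheb_joukowski n u Hu).
  replace ((u + / u) / 2)%C with (RtoC t) in E.
  - apply (f_equal Cmod) in E. rewrite Cmod_mult, Cmod_R, Rabs_pos_eq in E by lra.
    assert (T := Cmod_triangle (u ^ n) ((/ u) ^ n)).
    rewrite !Cmod_pow, Cmod_inv, Hm, Rinv_1, pow1 in T by exact Hu. lra.
  - rewrite Hi, <- re_alt. reflexivity.
Qed.

Lemma cdiff_cheb (n : nat) (F : C -> C) (z : C) : cdiff F z -> cdiff (fun w => cheb n (F w)) z.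
Proof.
  intros HF.
  assert (H : cdiff (fun w => cheb n (F w)) z /\ cdiff (fun w => cheb (S n) (F w)) z).
  { induction n as [|n [IH1 IH2]].
    - split. exact (cdiff_const 1 z). exact HF.
    - split. exact IH2.
      apply (cdiff_minus (fun w => 2 * F w * cheb (S n) (F w))%C (fun w => cheb n (F w))).
      2: exact IH1. apply (cdiff_mult (fun w => 2 * F w)%C (fun w => cheb (S n) (F w))). 2: exact IH2.
      apply cdiff_mult. apply cdiff_const. exact HF. }
  apply H.
Qed.

(** * The Joukowski map and confocal ellipses *)

Lemma Csqrt_ex (z : C) : exists s, (s * s)%C = z.
Proof.
  destruct z as [x y]. set (r := Cmod (x, y)).
  assert (Hx := re_le_Cmod (x, y)). simpl in Hx. fold r in Hx.
  destruct (proj1 (Rabs_le_between _ _) Hx) as [Hx1 Hx2].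
  assert (E : r ^ 2 = x ^ 2 + y ^ 2) by apply Cmod_pow2.
  assert (S1 := sqrt_sqrt ((r + x) / 2)). assert (S2 := sqrt_sqrt ((r - x) / 2)).
  lapply S1; [clear S1; intros S1|lra]. lapply S2; [clear S2; intros S2|lra].
  assert (S3 : sqrt ((r + x) / 2) * sqrt ((r - x) / 2) = Rabs y / 2).
  { rewrite <- sqrt_mult by lra. replace ((r + x) / 2 * ((r - x) / 2)) with (Rsqr (y / 2)).
    - rewrite sqrt_Rsqr_abs. unfold Rdiv. rewrite Rabs_mult, (Rabs_pos_eq (/ 2)) by lra. reflexivity.
    - unfold Rsqr. nra. }
  destruct (Rle_dec 0 y) as [Hy|Hy].
  - exists (sqrt ((r + x) / 2), sqrt ((r - x) / 2)).
    rewrite Rabs_pos_eq in S3 by exact Hy. apply injective_projections; simpl; lra.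
  - exists (sqrt ((r + x) / 2), - sqrt ((r - x) / 2)).
    rewrite Rabs_left in S3 by lra. apply injective_projections; simpl; lra.
Qed.

(** The two candidates [w + s] and [w - s], with [s] a square root of [w * w - 1], have product 1,
    so one of them has modulus at least 1. *)
Lemma joukowski_surj (w : C) : exists u : C, 1 <= Cmod u /\ w = ((u + / u) / 2)%C.
Proof.
  destruct (Csqrt_ex (w * w - 1)) as [s Hs].
  assert (P : ((w + s) * (w - s) = 1)%C).
  { replace ((w + s) * (w - s))%C with (w * w - s * s)%C by ring. rewrite Hs. ring. }
  assert (Pm := f_equal Cmod P). rewrite Cmod_mult, Cmod_1 in Pm.
  assert (N : forall u v : C, (u * v = 1)%C -> u <> 0).
  { intros u v Huv ->. rewrite Cmult_0_l in Huv. apply C1_nz. symmetry; exact Huv. }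
  assert (N1 := N _ _ P). assert (N2 : (w - s)%C <> 0) by (apply (N _ (w + s)%C); rewrite Cmult_comm; exact P).
  destruct (Rle_dec 1 (Cmod (w + s))) as [H|H].
  - exists (w + s)%C. split. exact H.
    replace (/ (w + s))%C with (w - s)%C. field.
    replace (w - s)%C with ((w + s) * (w - s) * / (w + s))%C by (field; exact N1). rewrite P. ring.
  - exists (w - s)%C. split.
    + assert (X := Cmod_ge_0 (w + s)). assert (Y := Cmod_ge_0 (w - s)). nra.
    + replace (/ (w - s))%C with (w + s)%C. field.
      replace (w + s)%C with ((w + s) * (w - s) * / (w - s))%C by (field; exact N2). rewrite P. ring.
Qed.

(* The ellipse with semi-axes [cosh t] and [sinh t], with denominators cleared as [sinh 0 = 0]. *)
Definition in_ellipse (t : R) (w : C) : Prop :=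
  Cmod w <= cosh t /\
  Im w ^ 2 * cosh t ^ 2 <= sinh t ^ 2 * (cosh t ^ 2 - Re w ^ 2).

(** The circle of radius [r] is mapped to the ellipse with semi-axes (r + 1/r)/2 and (r - 1/r)/2, a
    segment if r = 1. These ellipses have the same foci and grow with [r]. *)
Lemma in_ellipse_of_joukowski (t : R) (u : C) : 1 <= Cmod u <= exp t ->
  in_ellipse t ((u + / u) / 2)%C.
Proof.
  intros [H1 H2]. assert (Hu : u <> 0) by (apply Cmod_gt_0; lra).
  set (r := Cmod u) in *.
  assert (Hch : (r + / r) / 2 <= cosh t).
  { replace r with (exp (ln r)) by (apply exp_ln; lra).
    rewrite <- exp_Ropp. apply (cosh_le_compat (ln r) t). split.
    rewrite <- ln_1. apply ln_le; lra.
    rewrite <- (ln_exp t). apply ln_le; lra. }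
  split.
  - unfold Cdiv. rewrite Cmod_mult, Cmod_inv, Cmod_R, Rabs_pos_eq by (try lra; apply RtoC_neq_0; lra).
    eapply Rle_trans. 2: exact Hch. apply Rmult_le_compat_r. lra.
    eapply Rle_trans. apply Cmod_triangle. rewrite Cmod_inv by exact Hu. apply Rle_refl.
  - destruct u as [p q].
    assert (Er : p ^ 2 + q ^ 2 = r ^ 2) by (symmetry; apply Cmod_pow2).
    set (ch := (r + / r) / 2) in *. set (sh := (r - / r) / 2).
    assert (Ew : (((p, q) + / (p, q)) / 2)%C = (p / r * ch, q / r * sh)).
    { unfold ch, sh. apply injective_projections; simpl; simpl in Er; rewrite Er; field; lra. }
    rewrite Ew. change (Re (?x, ?y)) with x. change (Im (?x, ?y)) with y.
    assert (Hcs : (p / r) ^ 2 = 1 - (q / r) ^ 2).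
    { replace ((p / r) ^ 2) with ((p ^ 2 + q ^ 2) / r ^ 2 - (q / r) ^ 2) by (field; lra).
      rewrite Er. field. lra. }
    assert (Hchsh : sh ^ 2 = ch ^ 2 - 1) by (unfold ch, sh; field; lra).
    assert (HS : sinh t ^ 2 = cosh t ^ 2 - 1).
    { unfold sinh, cosh. rewrite exp_Ropp. field. apply Rgt_not_eq, exp_pos. }
    rewrite !Rpow_mult_distr, Hcs, Hchsh, HS.
    assert (Hch1 : 1 <= ch ^ 2) by (assert (X := pow2_ge_0 sh); lra).
    assert (Hch0 : 0 <= ch).
    { unfold ch. assert (0 < / r) by (apply Rinv_0_lt_compat; lra). lra. }
    assert (HC : ch ^ 2 <= cosh t ^ 2) by (apply pow_incr; lra).
    set (X := cosh t ^ 2) in *. set (Y := ch ^ 2) in *.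
    assert (Z := pow2_ge_0 (q / r)). set (s := (q / r) ^ 2) in *.
    (* With [s] the squared sine of the argument of [u], the two sides of the ellipse condition
       differ by exactly this sum. *)
    assert (0 <= (X - 1) * (X - Y) + s * (X - Y)).
    { apply Rplus_le_le_0_compat; apply Rmult_le_pos; lra. }
    lra.
Qed.

Lemma pow_exp (t : R) (n : nat) : exp t ^ n = exp (INR n * t).
Proof.
  induction n as [|n IH]. simpl. rewrite Rmult_0_l. symmetry; apply exp_0.
  rewrite S_INR, Rmult_plus_distr_r, exp_plus, <- IH, Rmult_1_l. simpl. ring.
Qed.

(* For [w = (u + 1/u)/2] with [|u| >= 1], [|cheb n w|] grows like [|u| ^ n / 2]. *)
Lemma in_ellipse_of_cheb (t : R) (w : C) : 0 <= t ->
  (forall n, Cmod (cheb n w) <= exp (INR n * t)) -> in_ellipse t w.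
Proof.
  intros Ht H. destruct (joukowski_surj w) as [u [Hu Hw]]. subst w.
  assert (Hu0 : u <> 0) by (apply Cmod_gt_0; lra).
  apply in_ellipse_of_joukowski. split. exact Hu.
  apply (le_of_pow_le _ _ 3). lra. left; apply exp_pos.
  intros n. rewrite <- Cmod_pow. specialize (H n).
  rewrite <- pow_exp in H.
  assert (E1 : 1 <= exp t ^ n).
  { apply pow_R1_Rle. rewrite <- exp_0. apply exp_le_compat. exact Ht. }
  replace (u ^ n)%C with (2 * cheb n ((u + / u) / 2) + - (/ u) ^ n)%C
    by (rewrite cheb_joukowski by exact Hu0; ring).
  eapply Rle_trans. apply Cmod_triangle.
  rewrite Cmod_opp, Cmod_mult, Cmod_R, Rabs_pos_eq by lra.
  assert (Cmod ((/ u) ^ n) <= 1); [|lra].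
  rewrite Cmod_pow, <- (pow1 n). apply pow_incr. split. apply Cmod_ge_0.
  rewrite Cmod_inv by exact Hu0. rewrite <- Rinv_1. apply Rinv_le_contravar; lra.
Qed.

(* The harmonic majorant on the square of side m is
   lambda y + 14 ((x - x0)^2 - y^2 + 2 m y)/m^2: nonnegative on the lower edge, where
   f/A lies in [-1, 1], and at least lambda y + 14 on the other three. *)
Lemma in_ellipse_above_center (f : C -> C) (A lambda m x0 : R) :
  0 < A -> 0 < lambda -> 0 < m ->
  (forall z, rect (x0 - m) (x0 + m) 0 m z -> cdiff f z) ->
  (forall x, Rabs (x - x0) <= m -> Im (f (x, 0)) = 0 /\ Cmod (f (x, 0)) <= A) ->
  (forall x y, Rabs (x - x0) <= m -> 0 <= y <= m ->
     Cmod (f (x, y)) <= A * exp (lambda * y + 12)) ->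
  forall y, 0 <= y <= m -> in_ellipse ((lambda + 28 / m) * y) (f (x0, y) / A)%C.
Proof.
  intros HA Hla Hm Hf Hreal Hbd y Hy.
  assert (HA0 : RtoC A <> 0) by (intros E; apply RtoC_inj in E; lra).
  assert (Hkap : 0 < lambda + 28 / m).
  { assert (0 < 28 / m) by (apply Rdiv_lt_0_compat; lra). lra. }
  apply in_ellipse_of_cheb. apply Rmult_le_pos; lra.
  intros n.
  set (G1 := fun z : C => (- Ci * lambda * z + 14 / (m * m) * ((z - x0) * (z - x0) - 2 * Ci * m * z))%C).
  assert (ReG1 : forall p q, Re (G1 (p, q)) =
     lambda * q + 14 * ((p - x0) ^ 2 - q ^ 2 + 2 * m * q) / (m * m)).
  { intros p q. unfold G1.
    replace (14 / (m * m))%C with (RtoC (14 / (m * m))).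
    2: { rewrite RtoC_div, RtoC_mult by nra. reflexivity. }
    rewrite re_plus, re_scal_l. simpl. field. lra. }
  (* Composition with T_n multiplies the Green function by about [n], so the majorant is scaled by
     [n]. *)
  set (G := fun z : C => (INR n * G1 z)%C).
  assert (ReG : forall z, Re (G z) = INR n * Re (G1 z)) by (intros z; apply re_scal_l).
  assert (Habs : forall x, x0 - m <= x <= x0 + m -> Rabs (x - x0) <= m)
    by (intros x Hx; apply Rabs_le; lra).
  assert (Hn := pos_INR n).
  assert (Main : Cmod (cheb n (f (x0, y) / A)%C) <= 1 * exp (Re (G (x0, y)))).
  { apply (weighted_max_modulus (fun z => cheb n (f z / A)%C) G (x0 - m) (x0 + m) 0 m 1 (x0, y)).
    - lra.
    - intros z Hz. apply (cdiff_cheb n (fun z => f z / A)%C).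
      apply (cdiff_mult f (fun _ => / A)%C). apply Hf, Hz. apply cdiff_const.
    - intros z Hz. apply (cdiff_mult (fun _ => RtoC (INR n)) G1). apply cdiff_const.
      unfold G1. apply cdiff_plus.
      + apply cdiff_mult. apply cdiff_const. apply cdiff_id.
      + apply cdiff_mult. apply cdiff_const. apply cdiff_minus.
        * apply cdiff_mult; (apply cdiff_minus; [apply cdiff_id|apply cdiff_const]).
        * apply cdiff_mult. apply cdiff_const. apply cdiff_id.
    - intros [p q] [[Z1 Z2] Z3]. simpl in Z1, Z2, Z3. rewrite Rmult_1_l, ReG.
      specialize (Habs p Z1).
      assert (Hlow : q = 0 -> Cmod (cheb n (f (p, q) / A)%C) <= exp (INR n * Re (G1 (p, q)))).
      { intros ->. destruct (Hreal p Habs) as [H1 H2].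
        replace (f (p, 0) / A)%C with (RtoC (Re (f (p, 0)) / A)).
        - eapply Rle_trans. apply Cmod_cheb_interval.
          + unfold Rdiv. rewrite Rabs_mult, (Rabs_pos_eq (/ A)) by (left; apply Rinv_0_lt_compat; lra).
            apply Rle_div_l. lra. rewrite Rmult_1_l.
            eapply Rle_trans. apply re_le_Cmod. exact H2.
          + rewrite <- exp_0. apply exp_le_compat. rewrite ReG1.
            apply Rmult_le_pos. exact Hn.
            replace (lambda * 0 + 14 * ((p - x0) ^ 2 - 0 ^ 2 + 2 * m * 0) / (m * m)) with
              (14 * ((p - x0) ^ 2 / (m * m))) by (field; lra).
            apply Rmult_le_pos. lra. apply Rdiv_le_0_compat. apply pow2_ge_0. nra.
        - rewrite RtoC_div by lra. f_equal.
          apply injective_projections; simpl; [reflexivity|symmetry; exact H1]. }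
      assert (Hup : m * m <= (p - x0) ^ 2 - q ^ 2 + 2 * m * q ->
         Cmod (cheb n (f (p, q) / A)%C) <= exp (INR n * Re (G1 (p, q)))).
      { intros Hge. eapply Rle_trans. apply Cmod_cheb_le.
        rewrite <- pow_exp. apply pow_incr. split.
        { assert (X := Cmod_ge_0 (f (p, q) / A)). lra. }
        rewrite Cmod_div, Cmod_R, Rabs_pos_eq by (try exact HA0; lra).
        assert (B : Cmod (f (p, q)) / A <= exp (lambda * q + 12)).
        { apply Rle_div_l. lra. rewrite Rmult_comm. apply Hbd; assumption. }
        assert (B1 : 1 <= exp (lambda * q + 12)).
        { rewrite <- exp_0. apply exp_le_compat.
          assert (0 <= lambda * q) by (apply Rmult_le_pos; lra). lra. }
        (* The factor 4 absorbs the coefficients of [Cmod_cheb_le] and is below [exp 2], which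
           raises the 12 of [Hbd] to the 14 in [G1]. *)
        apply Rle_trans with (4 * exp (lambda * q + 12)). lra.
        apply Rle_trans with (exp 2 * exp (lambda * q + 12)).
        - apply Rmult_le_compat_r. lra. replace 2 with (1 + 1) by ring. rewrite exp_plus.
          assert (X := exp_ineq1 1). assert (2 < exp 1) by lra. nra.
        - rewrite <- exp_plus. apply exp_le_compat. rewrite ReG1.
          assert (14 <= 14 * ((p - x0) ^ 2 - q ^ 2 + 2 * m * q) / (m * m)); [|lra].
          apply (proj1 (Rle_div_r _ _ (m * m) (Rmult_lt_0_compat _ _ Hm Hm))). lra. }
      destruct Z3 as [Z3 | [Z3 | [Z3 | Z3]]].
      + apply Hup. subst p. nra.
      + apply Hup. subst p. nra.
      + apply Hlow. exact Z3.
      + apply Hup. subst q. assert (X := pow2_ge_0 (p - x0)). nra.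
    - unfold rect; simpl. lra. }
  eapply Rle_trans. exact Main. rewrite Rmult_1_l. apply exp_le_compat.
  rewrite ReG. apply Rmult_le_compat_l. exact Hn. rewrite ReG1.
  replace ((x0 - x0) ^ 2) with 0 by ring.
  (* Above the center the weight is 14 (2 m y - y^2)/m^2; dropping the square leaves 28 y/m, the
     origin of 28. *)
  apply Rle_trans with (lambda * y + 14 * (2 * m * y) / (m * m)).
  - apply Rplus_le_compat_l. apply Rmult_le_compat_r. left; apply Rinv_0_lt_compat; nra.
    assert (X := pow2_ge_0 y). lra.
  - right. field. lra.
Qed.

(** * Derivative, reflection and zeros *)

(** A real increment [h > 0] changes [f] by a real amount, so the tolerance [Rabs (Im l) / 2] would
    be exceeded by the imaginary part of [l * h]. *)
Lemma im_derivative_real (f : C -> C) (x b : R) (l : C) : x < b ->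
  (forall t, x <= t <= b -> Im (f t) = 0) -> cderiv f x l -> Im l = 0.
Proof.
  intros Hxb Hre H. apply NNPP. intros Hn.
  assert (Hl : 0 < Rabs (Im l) / 2) by (apply Rdiv_lt_0_compat; [apply Rabs_pos_lt, Hn|lra]).
  destruct (H _ Hl) as [d [Hd H']].
  set (h := Rmin (d / 2) (b - x)).
  assert (Hh : 0 < h) by (apply Rmin_pos; lra).
  assert (Hh1 : h <= d / 2) by apply Rmin_l. assert (Hh2 : h <= b - x) by apply Rmin_r.
  assert (E : (RtoC (x + h) - RtoC x)%C = RtoC h) by (rewrite <- RtoC_minus; f_equal; ring).
  specialize (H' (RtoC (x + h))). rewrite E, Cmod_R, Rabs_pos_eq in H' by lra.
  lapply H'; [clear H'; intros H'|lra].
  assert (T := Rle_trans _ _ _ (im_le_Cmod _) H').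
  unfold Cminus in T. rewrite !im_plus, !im_opp, im_scal_r, !Hre in T by lra.
  replace (0 + - 0 + - (Im l * h)) with (- (Im l) * h) in T by ring.
  rewrite Rabs_mult, Rabs_Ropp, (Rabs_pos_eq h) in T by lra.
  apply Rmult_le_reg_r in T; [|exact Hh]. lra.
Qed.

Lemma sinh_le (t : R) : 0 <= t -> 0 <= sinh t <= t * exp t.
Proof.
  intros Ht. unfold sinh. split.
  - assert (X : exp (- t) <= exp t) by (apply exp_le_compat; lra). lra.
  - assert (X : 1 + - (2 * t) <= exp (- (2 * t))).
    { destruct (Req_dec t 0) as [->|Hn]. rewrite Rmult_0_r, Ropp_0, exp_0; lra.
      left; apply exp_ineq1; lra. }
    replace (- t) with (t + - (2 * t)) by ring. rewrite exp_plus.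
    assert (P := exp_pos t). nra.
Qed.

(* Let y -> 0 in the ellipse condition at x0 + i y: Im f / y -> f'(x0). *)
Lemma derivative_bound_of_ellipse (f : C -> C) (A ka m x0 : R) (l : C) :
  0 < A -> 0 < ka -> 0 < m -> cderiv f (x0, 0) l -> Im l = 0 -> Im (f (x0, 0)) = 0 ->
  (forall y, 0 <= y <= m -> in_ellipse (ka * y) (f (x0, y) / A)%C) ->
  Re l ^ 2 <= ka ^ 2 * (A ^ 2 - Re (f (x0, 0)) ^ 2).
Proof.
  intros HA Hka Hm Hl Hl0 Hf0 Hell.
  set (y := fun n => m / (INR n + 1)).
  assert (Hn1 : forall n, 1 <= INR n + 1) by (intros n; assert (X := pos_INR n); lra).
  assert (Hy : forall n, 0 < y n <= m).
  { intros n. specialize (Hn1 n). unfold y. split. apply Rdiv_lt_0_compat; lra.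
    apply Rle_div_l. lra. nra. }
  assert (Ly : is_lim_seq y 0).
  { unfold y, Rdiv. replace (Finite 0) with (Rbar_mult m 0) by (simpl; f_equal; ring).
    apply is_lim_seq_scal_l.
    replace (Finite 0) with (Rbar_inv p_infty) by reflexivity.
    apply is_lim_seq_inv. 2: discriminate.
    apply (is_lim_seq_ext (fun n => INR (S n))). intros n; apply S_INR.
    apply (proj1 (is_lim_seq_incr_1 INR p_infty)), is_lim_seq_INR. }
  (* Along the increment [i y] the linear term is [i y l] with [l] real: the real part of [f]
     changes by o(y), and the imaginary part is [Re l * y] up to o(y). *)
  assert (Small : forall e, 0 < e -> exists N, forall n, (N <= n)%nat ->
     Rabs (Re (f (x0, y n)) - Re (f (x0, 0))) <= e * y n /\
     Rabs (Im (f (x0, y n)) - Re l * y n) <= e * y n).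
  { intros e He. destruct (Hl e He) as [d [Hd H]].
    apply is_lim_seq_spec in Ly. destruct (Ly (mkposreal d Hd)) as [N HN]. simpl in HN.
    exists N. intros n Hn. specialize (HN n Hn). rewrite Rminus_0_r in HN.
    specialize (H (x0, y n)).
    replace ((x0, y n) - (x0, 0))%C with (Ci * RtoC (y n))%C in H
      by (apply injective_projections; simpl; ring).
    rewrite Cmod_mult, Cmod_Ci, Rmult_1_l, Cmod_R in H. specialize (H HN).
    assert (T1 := Rle_trans _ _ _ (re_le_Cmod _) H).
    assert (T2 := Rle_trans _ _ _ (im_le_Cmod _) H).
    rewrite (Rabs_pos_eq (y n)) in T1, T2 by (specialize (Hy n); lra).
    destruct l as [l1 l2]. simpl in Hl0. subst l2.
    unfold Cminus in T1, T2. rewrite !re_plus, !re_opp in T1. rewrite !im_plus, !im_opp in T2.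
    rewrite Hf0 in T2. simpl in T1, T2. simpl. split.
    - replace (Re (f (x0, y n)) - Re (f (x0, 0))) with
        (Re (f (x0, y n)) + - Re (f (x0, 0)) + - (l1 * (0 * y n - 1 * 0) - 0 * (0 * 0 + 1 * y n))) by ring.
      exact T1.
    - replace (Im (f (x0, y n)) - l1 * y n) with
        (Im (f (x0, y n)) + - 0 + - (l1 * (0 * 0 + 1 * y n) + 0 * (0 * y n - 1 * 0))) by ring.
      exact T2. }
  assert (Lu : is_lim_seq (fun n => Re (f (x0, y n))) (Re (f (x0, 0)))).
  { apply is_lim_seq_spec. intros e.
    assert (He : 0 < e / (2 * m)) by (apply Rdiv_lt_0_compat; [apply cond_pos|lra]).
    destruct (Small _ He) as [N HN]. exists N. intros n Hn.
    eapply Rle_lt_trans. apply (HN n Hn). specialize (Hy n).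
    apply Rle_lt_trans with (e / (2 * m) * m). apply Rmult_le_compat_l; lra.
    replace (e / (2 * m) * m) with (e / 2) by (field; lra).
    assert (X := cond_pos e). lra. }
  assert (Lv : is_lim_seq (fun n => Im (f (x0, y n)) / y n) (Re l)).
  { apply is_lim_seq_spec. intros e.
    assert (He : 0 < e / 2) by (assert (X := cond_pos e); lra).
    destruct (Small _ He) as [N HN]. exists N. intros n Hn.
    destruct (HN n Hn) as [_ T]. specialize (Hy n).
    replace (Im (f (x0, y n)) / y n - Re l) with ((Im (f (x0, y n)) - Re l * y n) / y n) by (field; lra).
    unfold Rdiv at 1. rewrite Rabs_mult, (Rabs_pos_eq (/ y n)) by (left; apply Rinv_0_lt_compat; lra).
    apply Rle_lt_trans with (e / 2); [|lra].
    apply Rle_div_l. lra. exact T. }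
  assert (Le : is_lim_seq (fun n => exp (ka * y n)) 1).
  { rewrite <- exp_0. apply is_lim_seq_continuous.
    - apply derivable_continuous, derivable_exp.
    - replace 0 with (ka * 0) by ring. apply (is_lim_seq_scal_l y ka 0), Ly. }
  (* The ellipse condition divided by y^2, with [cosh t] bounded by [exp t] and [sinh t] by
     [t * exp t]; the factor [t ^ 2 / y n ^ 2] is then the constant [ka ^ 2] and the limit is
     elementary. *)
  assert (Ineq : forall n, Im (f (x0, y n)) / y n * (Im (f (x0, y n)) / y n) <=
     ka * ka * (exp (ka * y n) * exp (ka * y n)) *
     (A * A * (exp (ka * y n) * exp (ka * y n)) - Re (f (x0, y n)) * Re (f (x0, y n)))).
  { intros n. specialize (Hy n). destruct (Hell (y n)) as [E1 E2]. lra.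
    set (t := ka * y n) in *.
    assert (Ht : 0 <= t) by (apply Rmult_le_pos; lra).
    replace (f (x0, y n) / A)%C with (/ A * f (x0, y n))%C in E1, E2
      by (unfold Cdiv; ring).
    rewrite <- RtoC_inv in E1, E2 by lra. rewrite re_scal_l, im_scal_l in E2.
    assert (E3 := Rle_trans _ _ _ (re_le_Cmod _) E1). rewrite re_scal_l in E3.
    set (p := Re (f (x0, y n))) in *. set (q := Im (f (x0, y n))) in *.
    assert (C1 : cosh t <= exp t).
    { eapply Rle_trans. apply cosh_le_exp_abs. rewrite Rabs_pos_eq by exact Ht. apply Rle_refl. }
    assert (C0 : 1 <= cosh t).
    { assert (X := cosh_le_compat 0 t (conj (Rle_refl 0) Ht)). rewrite cosh_0 in X. exact X. }
    assert (S0 := sinh_le t Ht).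
    assert (Q1 : (/ A * p) ^ 2 <= cosh t ^ 2).
    { rewrite <- (pow2_abs (/ A * p)). apply pow_incr. split. apply Rabs_pos. exact E3. }
    assert (Q2 : (/ A * q) ^ 2 <= (t * exp t) ^ 2 * (exp t ^ 2 - (/ A * p) ^ 2)).
    { apply Rle_trans with ((/ A * q) ^ 2 * cosh t ^ 2).
      - rewrite <- (Rmult_1_r ((/ A * q) ^ 2)) at 1. apply Rmult_le_compat_l. apply pow2_ge_0.
        rewrite <- (pow1 2). apply pow_incr; lra.
      - eapply Rle_trans. exact E2. apply Rmult_le_compat. apply pow2_ge_0. lra.
        apply pow_incr; exact S0.
        assert (cosh t ^ 2 <= exp t ^ 2) by (apply pow_incr; lra). lra. }
    apply (Rmult_le_compat_r (A ^ 2 / (y n) ^ 2)) in Q2.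
    2: { apply Rdiv_le_0_compat. apply pow2_ge_0. apply pow_lt; lra. }
    replace ((/ A * q) ^ 2 * (A ^ 2 / y n ^ 2)) with (q / y n * (q / y n)) in Q2 by (field; lra).
    eapply Rle_trans. exact Q2. right. unfold t at 1. field. lra. }
  assert (Lim1 : is_lim_seq (fun n => Im (f (x0, y n)) / y n * (Im (f (x0, y n)) / y n)) (Re l * Re l)).
  { apply is_lim_seq_mult'; exact Lv. }
  assert (Lim2 : is_lim_seq (fun n => ka * ka * (exp (ka * y n) * exp (ka * y n)) *
     (A * A * (exp (ka * y n) * exp (ka * y n)) - Re (f (x0, y n)) * Re (f (x0, y n))))
     (ka * ka * (1 * 1) * (A * A * (1 * 1) - Re (f (x0, 0)) * Re (f (x0, 0))))).
  { assert (Le2 := is_lim_seq_mult' _ _ _ _ Le Le).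
    apply is_lim_seq_mult'. apply is_lim_seq_mult'. apply is_lim_seq_const. exact Le2.
    apply is_lim_seq_minus'. apply is_lim_seq_mult'. apply is_lim_seq_const. exact Le2.
    apply is_lim_seq_mult'; exact Lu. }
  assert (R := is_lim_seq_le _ _ _ _ Ineq Lim1 Lim2). simpl in R.
  replace (Re l ^ 2) with (Re l * Re l) by ring.
  eapply Rle_trans. exact R. right. ring.
Qed.

(** Schwarz reflection straight from the definition: at a real point the derivative of [f] is real,
    so [f] and its reflection have the same value and the same linear expansion there and can be
    glued. *)
Lemma reflect_ext_cdiff (f : C -> C) (a b y0 : R) (z : C) :
  (forall z, rect a b 0 y0 z -> cdiff f z) ->
  (forall x : R, a <= x <= b -> Im (f x) = 0) ->
  a < Re z < b -> - y0 <= Im z <= y0 -> cdiff (reflect_ext f) z.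
Proof.
  intros Hf Hre Hx Hy. destruct (Rtotal_order (Im z) 0) as [Hz | [Hz | Hz]].
  - apply (cdiff_ext_loc (fun w => Cconj (f (Cconj w))) _ z (- Im z)). lra.
    + intros w Hw. unfold reflect_ext. destruct (Rle_dec 0 (Im w)) as [H|H]; [|reflexivity].
      exfalso. assert (T := im_le_Cmod (w - z)%C). unfold Cminus in T at 1.
      rewrite im_plus, im_opp in T.
      assert (X := Rle_abs (Im w + - Im z)). lra.
    + destruct (Hf (Cconj z)) as [l Hl].
      { unfold rect. rewrite re_conj, im_conj. lra. }
      exists (Cconj l). apply cderiv_conj, Hl.
  - destruct z as [x y]. simpl in Hx, Hy, Hz. subst y.
    destruct (Hf (x, 0)) as [l Hl]. { unfold rect; simpl; lra. }
    assert (Hl0 : Im l = 0).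
    { apply (im_derivative_real f x b l). lra. intros t Ht; apply Hre; lra. exact Hl. }
    assert (Hcl : Cconj l = l).
    { destruct l as [l1 l2]. simpl in Hl0. subst. unfold Cconj; simpl. f_equal. ring. }
    assert (Hcx : Cconj (x, 0) = (x, 0)) by (unfold Cconj; simpl; f_equal; ring).
    assert (Hcf : Cconj (f (x, 0)) = f (x, 0)).
    { assert (H0 : Im (f (x, 0)) = 0) by (apply (Hre x); lra).
      destruct (f (x, 0)) as [p q]. simpl in H0. subst. unfold Cconj; simpl. f_equal. ring. }
    assert (Hl2 : cderiv (fun w => Cconj (f (Cconj w))) (x, 0) (Cconj l)).
    { apply cderiv_conj. rewrite Hcx. exact Hl. }
    rewrite Hcl in Hl2. exists l. intros e He.
    destruct (Hl e He) as [d1 [Hd1 H1]]. destruct (Hl2 e He) as [d2 [Hd2 H2]].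
    exists (Rmin d1 d2). split. apply Rmin_pos; assumption.
    intros w Hw. assert (E0 : reflect_ext f (x, 0) = f (x, 0)).
    { unfold reflect_ext. simpl. destruct (Rle_dec 0 0) as [_|N]; [reflexivity|exfalso; lra]. }
    rewrite E0. unfold reflect_ext. destruct (Rle_dec 0 (Im w)).
    + apply H1. eapply Rlt_le_trans. exact Hw. apply Rmin_l.
    + rewrite Hcx, Hcf in H2. apply H2. eapply Rlt_le_trans. exact Hw. apply Rmin_r.
  - apply (cdiff_ext_loc f _ z (Im z)). lra.
    + intros w Hw. unfold reflect_ext. destruct (Rle_dec 0 (Im w)) as [H|H]; [reflexivity|].
      exfalso. assert (T := im_le_Cmod (w - z)%C). unfold Cminus in T at 1.
      rewrite im_plus, im_opp in T.
      assert (X := Rle_abs (- (Im w + - Im z))). rewrite Rabs_Ropp in X. lra.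
    + apply Hf. unfold rect. lra.
Qed.

(** * Products of linear factors and zero counting *)

Fixpoint root_prod (zs : list C) (w : C) : C :=
  match zs with nil => 1 | z :: zs' => ((w - z) * root_prod zs' w)%C end.

Lemma root_prod_cdiff (zs : list C) (w : C) : cdiff (root_prod zs) w.
Proof.
  induction zs as [|z zs IH].
  - exact (cdiff_const 1 w).
  - apply (cdiff_mult (fun w => w - z)%C (root_prod zs)). 2: exact IH.
    apply cdiff_minus. apply cdiff_id. apply cdiff_const.
Qed.

(** Collects the factors at [z]: the exponent is the multiplicity that [zeros_in] asks for, and the
    cofactor does not vanish at [z]. *)
Lemma root_prod_count (zs : list C) (z w : C) :
  root_prod zs w =
    ((w - z) ^ count_occ Ceq_dec zs z * root_prod (remove Ceq_dec z zs) w)%C.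
Proof.
  induction zs as [|u zs IH]; simpl.
  - ring.
  - destruct (Ceq_dec u z) as [E|E], (Ceq_dec z u) as [E'|E']; try congruence.
    + subst u. rewrite Cpow_S, IH. ring.
    + simpl. rewrite IH. ring.
Qed.

Lemma root_prod_neq_0 (zs : list C) (w : C) : ~ In w zs -> root_prod zs w <> 0.
Proof.
  induction zs as [|z zs IH]; simpl; intros H.
  - exact C1_nz.
  - apply Cmult_neq_0. apply Cminus_eq_contra. intros E; apply H; left; symmetry; exact E. apply IH; tauto.
Qed.

Lemma Cmod_root_prod_ge (zs : list C) (w : C) (m : R) : 0 <= m ->
  (forall z, In z zs -> m <= Cmod (w - z)%C) -> m ^ length zs <= Cmod (root_prod zs w).
Proof.
  intros Hm. induction zs as [|z zs IH]; simpl; intros H.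
  - rewrite Cmod_1. lra.
  - rewrite Cmod_mult. apply Rmult_le_compat; auto. apply pow_le, Hm.
Qed.

Lemma Cmod_root_prod_le (zs : list C) (w : C) (m : R) :
  (forall z, In z zs -> Cmod (w - z)%C <= m) -> Cmod (root_prod zs w) <= m ^ length zs.
Proof.
  induction zs as [|z zs IH]; simpl; intros H.
  - rewrite Cmod_1. lra.
  - rewrite Cmod_mult. apply Rmult_le_compat; auto; apply Cmod_ge_0.
Qed.

(* Divide out the zeros one at a time; every factorization F = prod (w - z_i) G satisfies
   |F(x0)| <= r^n sup |G| <= r^n M / (2 r)^n, so the process stops. *)
Lemma zeros_in_disk (F : C -> C) (x0 r M : R) : 0 < r ->
  (forall z, rect (x0 - 3 * r) (x0 + 3 * r) (- (3 * r)) (3 * r) z -> cdiff F z) ->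
  (forall z, rect_bd (x0 - 3 * r) (x0 + 3 * r) (- (3 * r)) (3 * r) z -> Cmod (F z) <= M) ->
  F x0 <> 0 ->
  exists zs, zeros_in F (disk x0 r) zs /\ 2 ^ length zs <= M / Cmod (F x0).
Proof.
  intros Hr HF HM HF0.
  set (a := x0 - 3 * r) in *. set (b := x0 + 3 * r) in *.
  set (c := - (3 * r)) in *. set (d := 3 * r) in *.
  assert (HM0 : 0 <= M).
  { eapply Rle_trans. apply Cmod_ge_0. apply (HM (a, 0)). unfold rect_bd, rect, a, b, c, d; simpl; lra. }
  assert (PF := proj1 (Cmod_gt_0 _) HF0).
  set (Inv := fun zs (G : C -> C) => (forall z, In z zs -> disk x0 r z) /\
    (forall w, F w = (root_prod zs w * G w)%C) /\ (forall z, rect a b c d z -> cdiff G z)).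
  assert (Hdisk : forall z, disk x0 r z -> rect_int a b c d z).
  { intros z Hz. unfold disk in Hz.
    assert (T1 := re_le_Cmod (z - x0)%C). assert (T2 := im_le_Cmod (z - x0)%C).
    unfold Cminus in T1 at 1, T2 at 1. rewrite re_plus, re_opp, re_RtoC in T1.
    rewrite im_plus, im_opp, im_RtoC in T2.
    assert (B1 := Rle_abs (Re z + - x0)). assert (B2 := Rle_abs (- (Re z + - x0))).
    assert (B3 := Rle_abs (Im z + - 0)). assert (B4 := Rle_abs (- (Im z + - 0))).
    rewrite Rabs_Ropp in B2, B4. unfold rect_int, a, b, c, d. lra. }
  assert (Hbound : forall zs G, Inv zs G -> 2 ^ length zs <= M / Cmod (F x0)).
  { intros zs G [I1 [I2 I3]].
    assert (P2r : 0 < (2 * r) ^ length zs) by (apply pow_lt; lra).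
    assert (HG : Cmod (G x0) <= M / (2 * r) ^ length zs).
    { apply (max_modulus G a b c d). apply Rdiv_le_0_compat; assumption. exact I3.
      - intros z Hz. apply Rle_div_r. exact P2r.
        eapply Rle_trans. 2: apply (HM z Hz). rewrite I2, Cmod_mult, Rmult_comm.
        apply Rmult_le_compat_r. apply Cmod_ge_0.
        apply Cmod_root_prod_ge. lra. intros u Hu. specialize (I1 u Hu). unfold disk in I1.
        (* The square has half-side [3 * r], so its boundary keeps distance at least [2 * r] from
           every zero in the disk; against the distance [r] from the center, each zero gains a
           factor 2. *)
        assert (Hz3 : 3 * r <= Cmod (z - x0)%C).
        { assert (T1 := re_le_Cmod (z - x0)%C). assert (T2 := im_le_Cmod (z - x0)%C).
          unfold Cminus in T1 at 1, T2 at 1. rewrite re_plus, re_opp, re_RtoC in T1.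
          rewrite im_plus, im_opp, im_RtoC in T2.
          assert (B1 := Rle_abs (Re z + - x0)). assert (B2 := Rle_abs (- (Re z + - x0))).
          assert (B3 := Rle_abs (Im z + - 0)). assert (B4 := Rle_abs (- (Im z + - 0))).
          rewrite Rabs_Ropp in B2, B4. destruct Hz as [_ Hz]. unfold a, b, c, d in Hz. lra. }
        replace (z - x0)%C with ((z - u) + (u - x0))%C in Hz3 by ring.
        assert (T := Cmod_triangle (z - u) (u - x0)). lra.
      - unfold rect, a, b, c, d; simpl. lra. }
    assert (HP : Cmod (root_prod zs x0) <= r ^ length zs).
    { apply Cmod_root_prod_le. intros u Hu. rewrite Cmod_sub_comm. left. apply I1, Hu. }
    apply Rle_div_r. exact PF. rewrite (I2 x0), Cmod_mult.
    apply Rle_trans with (2 ^ length zs * (r ^ length zs * (M / (2 * r) ^ length zs))).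
    - apply Rmult_le_compat_l. apply pow_le; lra.
      apply Rmult_le_compat; try apply Cmod_ge_0; assumption.
    - right. rewrite Rpow_mult_distr. field. split; apply pow_nonzero; lra. }
  (* After [k] rounds either the quotient has no zero left in the disk or [k] zeros have been
     extracted. For [k > M / Cmod (F x0)] the latter contradicts [Hbound], as [2 ^ k >= 1 + k]. *)
  assert (Hstep : forall k, (exists zs G, Inv zs G /\ forall z, disk x0 r z -> G z <> 0) \/
     (exists zs G, Inv zs G /\ length zs = k)).
  { induction k as [|k [IH|[zs [G [HI Hlen]]]]].
    - right. exists nil, F. split; [|reflexivity]. split; [|split].
      + intros z [].
      + intros w. simpl. ring.
      + exact HF.
    - left. exact IH.
    - destruct (classic (exists z, disk x0 r z /\ G z = 0)) as [[z [Hz Gz]]|Hno].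
      + right. destruct HI as [I1 [I2 I3]].
        destruct (difference_quotient_cdiff G a b c d z (Hdisk z Hz) I3) as [g [Hg1 Hg2]].
        exists (z :: zs), g. split.
        2: { simpl. rewrite Hlen. reflexivity. }
        split; [|split].
        * intros u [<-|Hu]. exact Hz. apply I1, Hu.
        * intros w. simpl. rewrite I2, (Hg1 w), Gz. ring.
        * intros u Hu. apply Hg2, I3, Hu.
      + left. exists zs, G. split. exact HI. intros z Hz Gz. apply Hno. exists z. split; assumption. }
  destruct (INR_unbounded (M / Cmod (F x0))) as [k Hk].
  destruct (Hstep k) as [[zs [G [HI HG]]]|[zs [G [HI Hlen]]]].
  - exists zs. split. 2: apply (Hbound zs G HI).
    destruct HI as [I1 [I2 I3]]. split. exact I1.
    (* The local cofactor at [z] is the product over the other zeros times [G], which has no zero in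
       the disk. If [z] is not in [zs], the exponent is 0 and this says [F z <> 0]. *)
    intros z Hz. exists (fun w => root_prod (remove Ceq_dec z zs) w * G w)%C. split; [|split].
    + exists (rect_int a b c d). split; [|split].
      * intros u Hu. apply locally_Cmod. apply rect_int_open. exact Hu.
      * intros u ->. apply Hdisk, Hz.
      * intros u Hu.
        assert (D : cdiff (fun w => root_prod (remove Ceq_dec z zs) w * G w)%C u).
        { apply (cdiff_mult (root_prod (remove Ceq_dec z zs)) G). apply root_prod_cdiff.
          apply I3. destruct Hu. unfold rect; lra. }
        destruct D as [l Hl]. exists l. apply is_derive_cderiv, Hl.
    + apply Cmult_neq_0. apply root_prod_neq_0, remove_In. apply HG, Hz.
    + apply filter_forall. intros w. rewrite I2, (root_prod_count zs z w). ring.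
  - exfalso. assert (B := Hbound zs G HI). rewrite Hlen in B.
    assert (X := poly k 1 Rlt_0_1). replace (1 + 1) with 2 in X by ring. lra.
Qed.

Lemma holomorphic_on_cdiff (f : C -> C) (S : C -> Prop) (z : C) :
  holomorphic_on f S -> S z -> cdiff f z.
Proof.
  intros [U [_ [HSU HU]]] Hz. destruct (HU z (HSU z Hz)) as [l Hl].
  exists l. apply is_derive_cderiv, Hl.
Qed.

Lemma Cmod_reflect_ext_le (f : C -> C) (x y B : R) :
  Cmod (f (x, Rabs y)) <= B -> Cmod (reflect_ext f (x, y)) <= B.
Proof.
  unfold reflect_ext. simpl. destruct (Rle_dec 0 y) as [H|H].
  - rewrite Rabs_pos_eq by exact H. trivial.
  - rewrite Rabs_left by lra. rewrite Cmod_conj. trivial.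
Qed.

Lemma ln_2_ge_half : / 2 <= ln 2.
Proof.
  assert (X := exp_le_3).
  rewrite <- (ln_exp (/ 2)). apply ln_le. apply exp_pos.
  apply Rsqr_incr_0; [|left; apply exp_pos|lra].
  unfold Rsqr. rewrite <- exp_plus. replace (/ 2 + / 2) with 1 by field. lra.
Qed.

(** The condition [r < m / 4] keeps the square of half-side [3 * r] inside the region of the growth
    bound. Taking logarithms in the bound on [2 ^ length zs] leaves [ln (A / Cmod (f x)) + 3 *
    lambda * r + 12], and [1 / ln 2 <= 2] turns the coefficients into at most 24. *)
Lemma zeros_near_center (f : C -> C) (a b y0 A lambda m x r : R) :
  0 < A -> 0 < lambda -> 0 < r < m / 4 -> m <= y0 -> a + m <= x <= b - m ->
  (forall z, rect a b 0 y0 z -> cdiff f z) ->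
  (forall t : R, a <= t <= b -> Im (f t) = 0) -> Cmod (f x) <= A ->
  (forall t y, Rabs (t - x) <= m -> 0 <= y <= m ->
     Cmod (f (t, y)) <= A * exp (lambda * y + 12)) ->
  f x <> 0 ->
  exists zs, zeros_in (reflect_ext f) (disk x r) zs /\
    INR (length zs) <= 24 * (1 + lambda * r + ln (A / Cmod (f x))).
Proof.
  intros HA Hla Hr Hm Hx Hf Hre Hfx Hbd Hf0.
  assert (E0 : reflect_ext f x = f x).
  { unfold reflect_ext. simpl. destruct (Rle_dec 0 0) as [_|N]; [reflexivity|exfalso; lra]. }
  assert (PF := proj1 (Cmod_gt_0 _) Hf0).
  destruct (zeros_in_disk (reflect_ext f) x r (A * exp (3 * (lambda * r) + 12)))
    as [zs [Hz Hlen]]. lra.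
  - intros z [Z1 Z2]. apply (reflect_ext_cdiff f a b y0 z Hf Hre); lra.
  - intros [t y] [[Z1 Z2] _]. simpl in Z1, Z2. apply Cmod_reflect_ext_le.
    assert (Hy : Rabs y <= 3 * r) by (apply Rabs_le; lra).
    assert (Hy0 := Rabs_pos y).
    eapply Rle_trans. apply Hbd. apply Rabs_le; lra. lra.
    apply Rmult_le_compat_l. lra. apply exp_le_compat.
    assert (lambda * Rabs y <= lambda * (3 * r)) by (apply Rmult_le_compat_l; lra). lra.
  - rewrite E0. exact Hf0.
  - exists zs. split. exact Hz. rewrite E0 in Hlen.
    apply ln_le in Hlen. 2: apply pow_lt; lra.
    rewrite ln_pow in Hlen by lra.
    replace (A * exp (3 * (lambda * r) + 12) / Cmod (f x)) with
      (A / Cmod (f x) * exp (3 * (lambda * r) + 12)) in Hlen by (field; lra).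
    assert (PA : 1 <= A / Cmod (f x)) by (apply Rle_div_r; lra).
    rewrite ln_mult, ln_exp in Hlen; [|lra|apply exp_pos].
    assert (PL : 0 <= ln (A / Cmod (f x))) by (rewrite <- ln_1; apply ln_le; lra).
    assert (PN := pos_INR (length zs)). assert (P2 := ln_2_ge_half).
    assert (0 <= lambda * r) by (apply Rmult_le_pos; lra).
    assert (INR (length zs) * / 2 <= INR (length zs) * ln 2) by (apply Rmult_le_compat_l; lra).
    lra.
Qed.

(** * The four estimates at a fixed center *)

Theorem theorem1p6 :
  exists K : R, 0 < K /\
  forall (a b y0 : R) (f : C -> C) (A lambda L : R),
    a < b -> 0 < y0 ->
    holomorphic_on f (rectangle a b y0) ->
    0 < A -> 0 < lambda -> 0 < L ->
    (forall x : R, a <= x <= b -> Im (f x) = 0 /\ Cmod (f x) <= A) ->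
    (forall x : R, a <= x <= b ->
       Cmod (f (x + Ci * y0)%C) <= A * exp (lambda * y0)) ->
    (forall x y : R, x = a \/ x = b -> 0 <= y <= y0 ->
       Cmod (f (x + Ci * y)%C)
         <= A * exp (lambda * y + exp (PI * L / (4 * y0)))) ->
    forall x : R, a <= x <= b -> L <= dist_endpoints a b x ->
      (exists e1 e2 : R,
         bigO K e1 (exp (- (PI * L / (4 * y0)))) /\
         bigO K e2 (1 / (lambda * Rmin y0 L)) /\
         Cmod (C_derive f x) <= A * lambda * (1 + e1 + e2))
      /\
      (exists e1 e2 : R,
         bigO K e1 (exp (- (PI * L / (4 * y0)))) /\
         bigO K e2 (1 / (lambda * Rmin y0 L)) /\
         Cmod (f x + Ci * C_derive f x / lambda)%C <= A * (1 + e1 + e2))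
      /\
      (forall y : R, 0 <= y <= y0 ->
         exists e1 e2 : R,
           bigO K e1 (exp (- (PI * L / (4 * y0)))) /\
           bigO K e2 (1 / (lambda * Rmin y0 L)) /\
           Cmod (f (x + Ci * y)%C)
             <= A * (1 + e1) * cosh ((1 + e2) * lambda * y))
      /\
      (forall r : R, 0 < r < Rmin y0 L / 4 -> f x <> RtoC 0 ->
         exists (zs : list C) (N : R),
           zeros_in (reflect_ext f) (disk x r) zs /\
           bigO K N (1 + lambda * r + ln (A / Cmod (f x))) /\
           INR (length zs) <= N).
Proof.
  (* 28 is the coefficient of y/m in [ka * y]; it also covers the 24 of the zero count. *)
  exists 28. split. lra.
  intros a b y0 f A lambda L Hab Hy0 Hhol HA Hla HL Hlow Hup Hver x Hx Hdist.
  assert (HxL : a + L <= x <= b - L).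
  { unfold dist_endpoints in Hdist.
    assert (T1 := Rle_trans _ _ _ Hdist (Rmin_l _ _)).
    assert (T2 := Rle_trans _ _ _ Hdist (Rmin_r _ _)).
    rewrite Rabs_pos_eq in T1 by lra. rewrite Rabs_left1 in T2 by lra. lra. }
  assert (Hf : forall z, rect a b 0 y0 z -> cdiff f z)
    by (intros z Hz; exact (holomorphic_on_cdiff f _ z Hhol Hz)).
  set (m := Rmin y0 L).
  assert (Hm : 0 < m) by (apply Rmin_pos; assumption).
  assert (Hmy : m <= y0) by apply Rmin_l. assert (HmL : m <= L) by apply Rmin_r.
  assert (Hbd : forall t y, Rabs (t - x) <= m -> 0 <= y <= y0 ->
     Cmod (f (t, y)) <= A * exp (lambda * y + 12)).
  { apply (bound_near_center a b y0 f A lambda L x); try assumption.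
    - intros t Ht. apply (Hlow t Ht).
    - intros t Ht. rewrite <- C_pair. apply Hup, Ht.
    - intros t y Ht Hy. rewrite <- C_pair. apply Hver; assumption. }
  set (ka := lambda + 28 / m).
  assert (Hkm : 0 < 28 / m) by (apply Rdiv_lt_0_compat; lra).
  assert (Hell : forall y, 0 <= y <= m -> in_ellipse (ka * y) (f (x, y) / A)%C).
  { apply in_ellipse_above_center; try assumption.
    - intros z [Z1 Z2]. apply Hf. unfold rect; lra.
    - intros t Ht. apply Hlow. destruct (proj1 (Rabs_le_between _ _) Ht). lra.
    - intros t y Ht Hy. apply Hbd; lra. }
  destruct (Hf (x, 0)) as [l Hl]. { unfold rect; simpl; lra. }
  assert (Hl0 : Im l = 0).
  { apply (im_derivative_real f x b l). lra. intros t Ht; apply Hlow; lra. exact Hl. }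
  destruct (Hlow x Hx) as [Hf0 HfA].
  assert (Hder : Re l ^ 2 <= ka ^ 2 * (A ^ 2 - Re (f x) ^ 2)).
  { apply (derivative_bound_of_ellipse f A ka m x l); try assumption. unfold ka; lra. }
  assert (HD : C_derive f x = l) by (apply C_derive_cderiv, Hl).
  assert (He2 : bigO 28 (28 * (1 / (lambda * m))) (1 / (lambda * m))).
  { unfold bigO. rewrite Rabs_pos_eq. apply Rle_refl.
    apply Rmult_le_pos. lra. apply Rdiv_le_0_compat. lra. apply Rmult_lt_0_compat; lra. }
  assert (He1 : bigO 28 0 (exp (- (PI * L / (4 * y0))))).
  { unfold bigO. rewrite Rabs_R0. apply Rmult_le_pos. lra. left; apply exp_pos. }
  assert (Hka : ka = lambda * (1 + 28 * (1 / (lambda * m)))) by (unfold ka; field; lra).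
  rewrite HD. split; [|split; [|split]].
  - exists 0, (28 * (1 / (lambda * m))). split; [exact He1|split; [exact He2|]].
    rewrite Rplus_0_r, Rmult_assoc, <- Hka.
    apply Rsqr_incr_0; [|apply Cmod_ge_0|apply Rmult_le_pos; unfold ka; lra].
    rewrite !Rsqr_pow2, Cmod2_alt, Hl0.
    assert (X := pow2_ge_0 (Re (f x))).
    assert (0 <= ka ^ 2 * Re (f x) ^ 2) by (apply Rmult_le_pos; [apply pow2_ge_0|exact X]).
    rewrite Rpow_mult_distr. lra.
  - exists 0, (28 * (1 / (lambda * m))). split; [exact He1|split; [exact He2|]].
    rewrite Rplus_0_r.
    replace (1 + 28 * (1 / (lambda * m))) with (ka / lambda) by (rewrite Hka; field; lra).
    apply Rsqr_incr_0; [|apply Cmod_ge_0|].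
    2: { apply Rmult_le_pos. lra. apply Rdiv_le_0_compat; unfold ka; lra. }
    replace (f x + Ci * l / lambda)%C with (Re (f x), Re l / lambda).
    + rewrite !Rsqr_pow2, Cmod_pow2.
      replace ((A * (ka / lambda)) ^ 2) with (ka ^ 2 * A ^ 2 / lambda ^ 2) by (field; lra).
      apply Rle_div_r. apply pow_lt, Hla.
      replace ((Re (f x) ^ 2 + (Re l / lambda) ^ 2) * lambda ^ 2) with
        (lambda ^ 2 * Re (f x) ^ 2 + Re l ^ 2) by (field; lra).
      (* [f x] and [l] are real, so the squared modulus is a sum of two squares. As [lambda <= ka],
         the term [ka ^ 2 * Re (f x) ^ 2] subtracted in [Hder] pays for the first of them. *)
      assert (lambda ^ 2 * Re (f x) ^ 2 <= ka ^ 2 * Re (f x) ^ 2).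
      { apply Rmult_le_compat_r. apply pow2_ge_0. apply pow_incr. unfold ka; lra. }
      lra.
    + destruct (f x) as [p q]. destruct l as [l1 l2]. simpl in Hf0, Hl0. subst.
      apply injective_projections; simpl; field; lra.
  - intros y Hy. exists 0, (28 * (1 / (lambda * m))). split; [exact He1|split; [exact He2|]].
    rewrite C_pair, Rplus_0_r, Rmult_1_r.
    replace ((1 + 28 * (1 / (lambda * m))) * lambda * y) with (ka * y) by (rewrite Hka; ring).
    (* The ellipse is available only up to height [m]. Above it [28 / m * y >= 28], so [cosh (ka *
       y) >= exp (lambda * y + 28) / 2], which exceeds the crude bound [exp (lambda * y + 12)]: the
       spare 16 in the exponent outweighs the factor 2. *)
    destruct (Rle_dec y m) as [Hym|Hym].
    + destruct (Hell y) as [E _]. lra.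
      rewrite Cmod_div, Cmod_R, Rabs_pos_eq in E by (try apply RtoC_neq_0; lra).
      apply (proj1 (Rle_div_l _ _ A HA)) in E. lra.
    + eapply Rle_trans. apply Hbd. 2: exact Hy.
      { replace (x - x) with 0 by ring. rewrite Rabs_R0. lra. }
      apply Rmult_le_compat_l. lra.
      apply Rle_trans with (exp (lambda * y + 28) / 2).
      * replace (lambda * y + 28) with (16 + (lambda * y + 12)) by ring.
        rewrite (exp_plus 16).
        assert (X := exp_ineq1 16). assert (P := exp_pos (lambda * y + 12)). nra.
      * eapply Rle_trans. 2: apply cosh_ge_half_exp.
        apply Rmult_le_compat_r. lra. apply exp_le_compat. unfold ka.
        assert (28 <= 28 / m * y); [|lra].
        replace 28 with (28 / m * m) at 1 by (field; lra).
        apply Rmult_le_compat_l; lra.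
  - intros r Hr Hfx.
    destruct (zeros_near_center f a b y0 A lambda m x r) as [zs [Hz Hlen]]; try assumption.
    + lra.
    + intros t Ht; apply Hlow, Ht.
    + intros t y Ht Hy; apply Hbd; lra.
    + exists zs, (INR (length zs)). split; [exact Hz|split; [|apply Rle_refl]].
      unfold bigO. rewrite Rabs_pos_eq by apply pos_INR.
      eapply Rle_trans. exact Hlen. apply Rmult_le_compat_r; [|lra].
      assert (PF := proj1 (Cmod_gt_0 _) Hfx).
      assert (PL : 0 <= ln (A / Cmod (f x))).
      { rewrite <- ln_1. apply ln_le. lra. apply Rle_div_r; lra. }
      assert (0 <= lambda * r) by (apply Rmult_le_pos; lra). lra.
Qed.
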